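(* The Hochschild homology $HH_n(A)$ vanishes for all $n\neq 0,1$.
   Context: $\mathbf{k}$ is a field of characteristic $0$, $A=\mathbf{k}\langle x,y,z\rangle/(x^2+yx,\,xz,\,zy)$, $A^e=A\otimes A^{\mathrm{op}}$, and $HH_n(A)=\mathrm{Tor}_n^{A^e}(A,A)$. *)

(* Defs.v *)
From HB Require Import structures.
From mathcomp Require Import all_boot all_algebra.
From mathcomp Require Import generic_quotient ring_quotient.
From mathcomp Require Import boolp.
From mathcomp Require Import finmap monalg.

Set Implicit Arguments.
Unset Strict Implicit.
Unset Printing Implicit Defensive.

Import GRing.Theory.
Local Open Scope ring_scope.
Local Open Scope quotient_scope.

(* [zspan S] is the additive subgroup generated by S; membership is made
   boolean with classical logic so that the quotients of ring_quotient apply. *)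
Section SubgroupSpan.
Variables (V : zmodType) (S : V -> Prop).

Inductive in_zspan : V -> Prop :=
| zspan_gen v of S v : in_zspan v
| zspan0 : in_zspan 0
| zspanB u v of in_zspan u & in_zspan v : in_zspan (u - v).

Definition zspan : {pred V} := [pred v | `[< in_zspan v >]].

Lemma zspanP v : reflect (in_zspan v) (v \in zspan).
Proof. exact: asboolP. Qed.

Fact zspan_closed : zmod_closed zspan.
Proof.
split=> [|u v /zspanP uS /zspanP vS]; apply/zspanP; [exact: zspan0|].
exact: zspanB.
Qed.
HB.instance Definition _ := GRing.isZmodClosed.Build V zspan zspan_closed.
End SubgroupSpan.

(* [ideal S] is the two-sided ideal generated by S. *)
Section IdealSpan.
Variables (R : pzRingType) (S : R -> Prop).

Inductive in_ideal : R -> Prop :=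
| ideal_gen r of S r : in_ideal r
| ideal0 : in_ideal 0
| idealB u v of in_ideal u & in_ideal v : in_ideal (u - v)
| idealMl r u of in_ideal u : in_ideal (r * u)
| idealMr r u of in_ideal u : in_ideal (u * r).

Definition ideal : {pred R} := [pred r | `[< in_ideal r >]].

Lemma idealP r : reflect (in_ideal r) (r \in ideal).
Proof. exact: asboolP. Qed.

Fact ideal_zmod_closed : zmod_closed ideal.
Proof.
split=> [|u v /idealP uS /idealP vS]; apply/idealP; [exact: ideal0|].
exact: idealB.
Qed.
HB.instance Definition _ := GRing.isZmodClosed.Build R ideal ideal_zmod_closed.
End IdealSpan.

Section AlgebraQuotient.
Variables (k : pzRingType) (F : algType k) (S : F -> Prop).

Definition alg_quot := Quotient.quot (ideal S).
HB.instance Definition _ := GRing.Zmodule.on alg_quot.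

Definition alg_quot_pi (x : F) : alg_quot := \pi_(Quotient.quot (ideal S)) x.
Local Notation pi := alg_quot_pi.

Lemma alg_quot_pi_eq x y : (pi x = pi y) <-> in_ideal S (x - y).
Proof.
split=> [/eqP|xy]; first by rewrite -Quotient.idealrBE => /idealP.
by apply/eqP; rewrite -Quotient.idealrBE; apply/idealP.
Qed.

Lemma alg_quot_piB x y : pi (x - y) = pi x - pi y.
Proof. exact: (raddfB (\pi_(Quotient.quot (ideal S)))). Qed.

Lemma alg_quot_piD x y : pi (x + y) = pi x + pi y.
Proof. exact: (raddfD (\pi_(Quotient.quot (ideal S)))). Qed.

Lemma alg_quot_pi0 : pi 0 = 0.
Proof. exact: (raddf0 (\pi_(Quotient.quot (ideal S)))). Qed.

Lemma alg_quotW (P : alg_quot -> Prop) : (forall x, P (pi x)) -> forall q, P q.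
Proof. by move=> Ppi q; rewrite -[q](reprK (q : Quotient.quot (ideal S))); exact: Ppi. Qed.

Definition alg_quot_mul (p q : alg_quot) : alg_quot := pi (repr p * repr q).
Definition alg_quot_scale (a : k) (q : alg_quot) : alg_quot := pi (a *: repr q).

Lemma in_ideal_repr x : in_ideal S (repr (pi x) - x).
Proof. by apply/alg_quot_pi_eq; exact: (reprK (pi x : Quotient.quot (ideal S))). Qed.

Lemma alg_quot_piM x y : alg_quot_mul (pi x) (pi y) = pi (x * y).
Proof.
apply/alg_quot_pi_eq; set x' := repr _; set y' := repr _.
have -> : x' * y' - x * y = (x' - x) * y' - x * (y - y').
  by rewrite mulrBl mulrBr opprB addrC addrA subrK addrC.
apply: idealB; first by apply: idealMr; exact: in_ideal_repr.
apply: idealMl; rewrite -[y - y']opprB -[- _]sub0r.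
by apply: idealB; [exact: ideal0|exact: in_ideal_repr].
Qed.

Lemma alg_quot_piZ a x : alg_quot_scale a (pi x) = pi (a *: x).
Proof.
apply/alg_quot_pi_eq; rewrite -scalerBr -[_ - x]mul1r scalerAl.
by apply: idealMl; exact: in_ideal_repr.
Qed.

Fact alg_quot_mulA : associative alg_quot_mul.
Proof.
elim/alg_quotW=> x; elim/alg_quotW=> y; elim/alg_quotW=> z.
by rewrite !alg_quot_piM mulrA.
Qed.

Fact alg_quot_mul1 : left_id (pi 1) alg_quot_mul.
Proof. by elim/alg_quotW=> x; rewrite alg_quot_piM mul1r. Qed.

Fact alg_quot_mulr1 : right_id (pi 1) alg_quot_mul.
Proof. by elim/alg_quotW=> x; rewrite alg_quot_piM mulr1. Qed.

Fact alg_quot_mulDl : left_distributive alg_quot_mul +%R.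
Proof.
elim/alg_quotW=> x; elim/alg_quotW=> y; elim/alg_quotW=> z.
by rewrite !(alg_quot_piM, =^~ alg_quot_piD) mulrDl.
Qed.

Fact alg_quot_mulDr : right_distributive alg_quot_mul +%R.
Proof.
elim/alg_quotW=> x; elim/alg_quotW=> y; elim/alg_quotW=> z.
by rewrite !(alg_quot_piM, =^~ alg_quot_piD) mulrDr.
Qed.

HB.instance Definition _ := GRing.Zmodule_isPzRing.Build alg_quot
  alg_quot_mulA alg_quot_mul1 alg_quot_mulr1 alg_quot_mulDl alg_quot_mulDr.

Fact alg_quot_scaleA a b q :
  alg_quot_scale a (alg_quot_scale b q) = alg_quot_scale (a * b) q.
Proof. by elim/alg_quotW: q => x; rewrite !alg_quot_piZ scalerA. Qed.

Fact alg_quot_scale1 : left_id 1 alg_quot_scale.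
Proof. by elim/alg_quotW=> x; rewrite alg_quot_piZ scale1r. Qed.

Fact alg_quot_scaleDr : right_distributive alg_quot_scale +%R.
Proof.
move=> a; elim/alg_quotW=> x; elim/alg_quotW=> y.
by rewrite !(alg_quot_piZ, =^~ alg_quot_piD) scalerDr.
Qed.

Fact alg_quot_scaleDl q : {morph alg_quot_scale^~ q : a b / a + b}.
Proof.
move=> a b; elim/alg_quotW: q => x.
by rewrite !(alg_quot_piZ, =^~ alg_quot_piD) scalerDl.
Qed.

HB.instance Definition _ := GRing.Zmodule_isLmodule.Build k alg_quot
  alg_quot_scaleA alg_quot_scale1 alg_quot_scaleDr alg_quot_scaleDl.

Lemma alg_quot_mulE x y : pi x * pi y = pi (x * y).
Proof. exact: alg_quot_piM. Qed.

Lemma alg_quot_scaleE a x : a *: pi x = pi (a *: x).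
Proof. exact: alg_quot_piZ. Qed.

Lemma alg_quot_scaleAl a (u v : alg_quot) : a *: (u * v) = (a *: u) * v.
Proof.
elim/alg_quotW: u => x; elim/alg_quotW: v => y.
by rewrite alg_quot_mulE !alg_quot_scaleE alg_quot_mulE scalerAl.
Qed.

Lemma alg_quot_scaleAr a (u v : alg_quot) : a *: (u * v) = u * (a *: v).
Proof.
elim/alg_quotW: u => x; elim/alg_quotW: v => y.
by rewrite alg_quot_mulE !alg_quot_scaleE alg_quot_mulE scalerAr.
Qed.

End AlgebraQuotient.

(* The free (noncommutative) algebra on I: {fmonom I} is the free monoid. *)
Definition free_alg (k : comNzRingType) (I : choiceType) := {malg k[{fmonom I}]}.
HB.instance Definition _ (k : comNzRingType) (I : choiceType) :=
  GRing.Lalgebra.on (free_alg k I).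

Fact free_alg_scaleAr (k : comNzRingType) (I : choiceType) (a : k) (u v : free_alg k I) :
  a *: (u * v) = u * (a *: v).
Proof.
rewrite scalerAl -(mul_malgC a v) mulrA; congr (_ * _).
rewrite malgZ_def malgM_def fgmulgU.
by apply: eq_bigr => l _; rewrite mulm1 mulrC.
Qed.
HB.instance Definition _ (k : comNzRingType) (I : choiceType) :=
  GRing.Lalgebra_isAlgebra.Build k (free_alg k I) (@free_alg_scaleAr k I).

Section IdealKernel.
Variables (R K : pzRingType) (f : {rmorphism R -> K}).

Lemma in_ideal_ker (T : R -> Prop) :
  (forall r, T r -> f r = 0) -> forall u, in_ideal T u -> f u = 0.
Proof.
move=> fT u; elim=> [r /fT //||v w _ fv _ fw|v w _ fw|v w _ fw].
- exact: rmorph0.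
- by rewrite rmorphB fv fw subrr.
- by rewrite rmorphM fw mulr0.
- by rewrite rmorphM fw mul0r.
Qed.

Lemma product_vanish (x y : R) : f x = 0 -> f (x * y) = 0.
Proof. by move=> fx; rewrite rmorphM fx mul0r. Qed.

Lemma quadratic_vanish (x y : R) : f x = 0 -> f (x ^+ 2 + y * x) = 0.
Proof. by move=> fx; rewrite rmorphD rmorphXn rmorphM fx mulr0 expr2 mul0r addr0. Qed.
End IdealKernel.

Section TheAlgebra.
Variable k : fieldType.

Definition free3 := free_alg k 'I_3.
HB.instance Definition _ := GRing.Algebra.on free3.

Definition gen (i : nat) : free3 := << fmu (inord i : 'I_3) >>.
Local Notation X := (gen 0).
Local Notation Y := (gen 1).
Local Notation Z := (gen 2).

(* The generators x, y, z are gen 0, gen 1, gen 2. *)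
Variant relations : free3 -> Prop :=
| rel_xx_yx : relations (X ^+ 2 + Y * X)
| rel_xz : relations (X * Z)
| rel_zy : relations (Z * Y).

(* A = k<x,y,z> / (x^2 + yx, xz, zy). *)
Definition algA := alg_quot relations.
HB.instance Definition _ := GRing.PzRing.on algA.
HB.instance Definition _ := GRing.Lmodule.on algA.

(* The constant term, which shows that A is a nontrivial ring. *)
Definition augmentation : free3 -> k := mcoeff (@mone {fmonom 'I_3}).
HB.instance Definition _ := GRing.RMorphism.on augmentation.

Fact augmentation_gen i : augmentation (gen i) = 0.
Proof. by rewrite /augmentation mcoeffU1 fm1_eq1. Qed.

Fact augmentation_relations r : relations r -> augmentation r = 0.
Proof.
by case; [apply: quadratic_vanish|apply: product_vanish|apply: product_vanish];
  exact: augmentation_gen.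
Qed.

Fact algA_oner_neq0 : (1 : algA) != 0.
Proof.
apply/eqP=> eq10; have /alg_quot_pi_eq : alg_quot_pi relations 1 = alg_quot_pi relations 0.
  by rewrite alg_quot_pi0.
rewrite subr0 => /(in_ideal_ker augmentation_relations).
by rewrite rmorph1 => /eqP; rewrite oner_eq0.
Qed.
HB.instance Definition _ := GRing.PzSemiRing_isNonZero.Build algA algA_oner_neq0.

HB.instance Definition _ :=
  GRing.Lmodule_isLalgebra.Build k algA (@alg_quot_scaleAl k free3 relations).
HB.instance Definition _ :=
  GRing.Lalgebra_isAlgebra.Build k algA (@alg_quot_scaleAr k free3 relations).

End TheAlgebra.

(* Right R-modules are encoded as left modules over the converse ring R^c.
   [tensor M N] is the abelian group M (x)_R N: the free abelian group on M * N
   modulo biadditivity and (m r, n) ~ (m, r n). *)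
Section TensorProduct.
Variables (R : pzRingType) (M : lmodType R^c) (N : lmodType R).

Local Notation free := {malg int[(M * N)%type]}.

Definition basis m n : free := << (m, n) >>.

Variant tens_relation : free -> Prop :=
| tens_relDl m m' n :
    tens_relation (basis (m + m') n - basis m n - basis m' n)
| tens_relDr m n n' :
    tens_relation (basis m (n + n') - basis m n - basis m n')
| tens_relZ m (r : R) n :
    tens_relation (basis ((r : R^c) *: m) n - basis m (r *: n)).

Definition tensor := Quotient.quot (zspan tens_relation).
HB.instance Definition _ := GRing.Zmodule.on tensor.

Definition tens_pi (x : free) : tensor := \pi_(Quotient.quot (zspan tens_relation)) x.

Definition tens (m : M) (n : N) : tensor := tens_pi (basis m n).

Lemma tens_piB x y : tens_pi (x - y) = tens_pi x - tens_pi y.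
Proof. exact: (raddfB (\pi_(Quotient.quot (zspan tens_relation)))). Qed.

Fact tens_pi_zmod_morphism : zmod_morphism tens_pi.
Proof. exact: tens_piB. Qed.
HB.instance Definition _ :=
  GRing.isZmodMorphism.Build free tensor tens_pi tens_pi_zmod_morphism.

Lemma tens_pi_eq x y : tens_pi x = tens_pi y <-> in_zspan tens_relation (x - y).
Proof.
split=> [/eqP|xy]; first by rewrite -Quotient.idealrBE => /zspanP.
by apply/eqP; rewrite -Quotient.idealrBE; apply/zspanP.
Qed.

Lemma tens_pi_rel x : tens_relation x -> tens_pi x = 0.
Proof.
by move=> relx; rewrite -(raddf0 tens_pi); apply/tens_pi_eq; rewrite subr0; apply: zspan_gen.
Qed.

Lemma tensDl m m' n : tens (m + m') n = tens m n + tens m' n.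
Proof.
have := tens_pi_rel (tens_relDl m m' n).
by rewrite !raddfB => eq0; apply/eqP; rewrite -subr_eq0 opprD addrA; apply/eqP.
Qed.

Lemma tensDr m n n' : tens m (n + n') = tens m n + tens m n'.
Proof.
have := tens_pi_rel (tens_relDr m n n').
by rewrite !raddfB => eq0; apply/eqP; rewrite -subr_eq0 opprD addrA; apply/eqP.
Qed.

Lemma tensZ m (r : R) n : tens ((r : R^c) *: m) n = tens m (r *: n).
Proof.
have := tens_pi_rel (tens_relZ m r n).
by rewrite raddfB => eq0; apply/eqP; rewrite -subr_eq0; apply/eqP.
Qed.

Lemma tens_ind (P : tensor -> Prop) :
    P 0 -> (forall x y, P x -> P y -> P (x - y)) ->
    (forall m n, P (tens m n)) ->
  forall x, P x.
Proof.
move=> P0 PB Pt x; rewrite -[x](reprK (x : Quotient.quot (zspan tens_relation))).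
have PN y : P y -> P (- y) by move=> Py; rewrite -sub0r; apply: PB.
have PD y z : P y -> P z -> P (y + z).
  by move=> Py Pz; rewrite -[z]opprK; apply: PB => //; apply: PN.
change (P (tens_pi (repr (x : Quotient.quot (zspan tens_relation))))).
rewrite (monalgE (repr _)) raddf_sum; apply: big_ind => // -[m n] _ /=.
have Pn (c : nat) : P (tens_pi << c%:Z *g (m, n) >>).
  elim: c => [|c IHc]; first by rewrite monalgU0 raddf0.
  by rewrite intS monalgUD raddfD; apply: PD => //; apply: Pt.
by case: (_ @_ _) => c; rewrite // NegzE monalgUN raddfN; apply: PN.
Qed.

Section Lift.
Variables (V : zmodType) (f : M -> N -> V).

Definition balanced :=
  [/\ forall m m' n, f (m + m') n = f m n + f m' n,
      forall m n n', f m (n + n') = f m n + f m n'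
    & forall m (r : R) n, f ((r : R^c) *: m) n = f m (r *: n)].

Definition free_lift (x : free) : V :=
  \sum_(p <- msupp x) f p.1 p.2 *~ x@_p.

Definition tens_lift (x : tensor) : V := free_lift (repr x).

Lemma free_liftw (d : {fset (M * N)%type}) (x : free) : (msupp x `<=` d)%fset ->
  free_lift x = \sum_(p <- d) f p.1 p.2 *~ x@_p.
Proof.
by move=> le; apply: big_fset_incl => // p _ /mcoeff_outdom ->; rewrite mulr0z.
Qed.

Lemma free_liftB x y : free_lift (x - y) = free_lift x - free_lift y.
Proof.
pose d := (msupp x `|` msupp y)%fset.
rewrite (@free_liftw d (x - y)) ?msuppB_le // (@free_liftw d x) ?fsubsetUl //.
rewrite (@free_liftw d y) ?fsubsetUr // -sumrB.
by apply: eq_bigr => p _; rewrite mcoeffB mulrzBr.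
Qed.

Lemma free_liftU m n : free_lift (basis m n) = f m n.
Proof.
by rewrite /basis (free_liftw msuppU_le) big_seq_fset1 mcoeffUU.
Qed.

Hypothesis f_bal : balanced.

Lemma free_lift_span x : in_zspan tens_relation x -> free_lift x = 0.
Proof.
case: f_bal => fDl fDr fZ; elim=> [_ [m m' n|m n n'|m r n]||u v _ fu _ fv].
- by rewrite !free_liftB !free_liftU fDl addrAC addrK subrr.
- by rewrite !free_liftB !free_liftU fDr addrAC addrK subrr.
- by rewrite free_liftB !free_liftU fZ subrr.
- by rewrite /free_lift msupp0 big_seq_fset0.
- by rewrite free_liftB fu fv subrr.
Qed.

Lemma tens_lift_pi x : tens_lift (tens_pi x) = free_lift x.
Proof.
apply/eqP; rewrite -subr_eq0 -free_liftB; apply/eqP/free_lift_span/tens_pi_eq.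
exact: (reprK (tens_pi x : Quotient.quot (zspan tens_relation))).
Qed.

Lemma tens_liftE m n : tens_lift (tens m n) = f m n.
Proof. by rewrite tens_lift_pi free_liftU. Qed.

Lemma tens_lift_zmod_morphism : zmod_morphism tens_lift.
Proof.
move=> x y; rewrite -[x](reprK (x : Quotient.quot (zspan tens_relation))).
rewrite -[y](reprK (y : Quotient.quot (zspan tens_relation))).
rewrite -[LHS]/(tens_lift (tens_pi _ - tens_pi _)) -tens_piB.
by rewrite tens_lift_pi free_liftB -!tens_lift_pi.
Qed.
End Lift.

End TensorProduct.

Section TensorMap.
Variables (R : pzRingType) (M : lmodType R^c) (N N' : lmodType R).
Variable g : {linear N -> N'}.

Definition tens_map : tensor M N -> tensor M N' :=
  tens_lift (fun m n => tens m (g n)).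

Fact tens_map_balanced : balanced (fun m n => tens m (g n) : tensor M N').
Proof.
split=> [m m' n|m n n'|m r n]; first exact: tensDl.
- by rewrite raddfD tensDr.
- by rewrite tensZ linearZ.
Qed.

Fact tens_map_zmod_morphism : zmod_morphism tens_map.
Proof. exact/tens_lift_zmod_morphism/tens_map_balanced. Qed.
HB.instance Definition _ := GRing.isZmodMorphism.Build _ _ tens_map
  tens_map_zmod_morphism.

Lemma tens_mapE m n : tens_map (tens m n) = tens m (g n).
Proof. exact/tens_liftE/tens_map_balanced. Qed.
End TensorMap.
Arguments tens_map {R} M {N N'} g.

(* Homology ker d / im d' at the middle term of X -d'-> Y -d-> Z. *)
Section Homology.
Variables (X Y Z : zmodType) (d' : {additive X -> Y}) (d : {additive Y -> Z}).

Definition cycle_pred : {pred Y} := [pred y | d y == 0].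

Fact cycle_closed : zmod_closed cycle_pred.
Proof.
split=> [|x y]; rewrite !inE ?raddf0 // => /eqP dx /eqP dy.
by rewrite raddfB dx dy subrr.
Qed.
HB.instance Definition _ := GRing.isZmodClosed.Build Y cycle_pred cycle_closed.

Record cycles := Cycle { cycle_val : Y; _ : cycle_val \in cycle_pred }.
HB.instance Definition _ := [isSub for cycle_val].
HB.instance Definition _ := [Choice of cycles by <:].
HB.instance Definition _ := [SubChoice_isSubZmodule of cycles by <:].

Definition boundaries : {pred cycles} :=
  [pred z | `[< exists x, d' x = cycle_val z >]].

Fact boundaries_closed : zmod_closed boundaries.
Proof.
split=> [|u v /asboolP[x dx] /asboolP[y dy]]; apply/asboolP.
  by exists 0; rewrite !raddf0.
by exists (x - y); rewrite !raddfB /= dx dy.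
Qed.
HB.instance Definition _ :=
  GRing.isZmodClosed.Build cycles boundaries boundaries_closed.

Definition homology := Quotient.quot boundaries.
HB.instance Definition _ := GRing.Zmodule.on homology.
End Homology.

Section ProjectiveResolution.
Variable R : pzRingType.

Definition projective (P : lmodType R) :=
  forall (M N : lmodType R) (f : {linear M -> N}) (g : {linear P -> N}),
    (forall y, exists x, f x = y) ->
  exists h : {linear P -> M}, forall p, f (h p) = g p.

Record projective_resolution (N : lmodType R) := ProjectiveResolution {
  res_mod :> nat -> lmodType R;
  res_diff : forall n, {linear res_mod n.+1 -> res_mod n};
  res_aug : {linear res_mod 0%N -> N};
  res_projective : forall n, projective (res_mod n);
  res_aug_surj : forall y, exists x, res_aug x = y;
  res_exact0 : forall x, res_aug x = 0 <-> exists y, res_diff 0%N y = x;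
  res_exactS : forall n x, res_diff n x = 0 <-> exists y, res_diff n.+1 y = x
}.
End ProjectiveResolution.

(* Tor_n^R(M, N), computed from a projective resolution P of N as the n-th
   homology of M (x)_R P; the map out of degree 0 is zero. *)
Section Tor.
Variables (R : pzRingType) (M : lmodType R^c) (N : lmodType R).
Variable P : projective_resolution N.

Definition Tor (n : nat) : zmodType :=
  match n with
  | 0 => homology (tens_map M (res_diff P 0%N)) (\0 : tensor M (P 0%N) -> tensor M (P 0%N))
  | m.+1 => homology (tens_map M (res_diff P m.+1)) (tens_map M (res_diff P m))
  end.
End Tor.

Section FreeModule.
Variables (R : pzRingType) (K : choiceType).

Definition free_module := {malg R[K]}.
HB.instance Definition _ := GRing.Zmodule.on free_module.

Definition free_scale (c : R) (g : free_module) : free_module :=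
  \sum_(i <- msupp g) << c * g@_i *g i >>.

Fact free_scaleE c g i : (free_scale c g)@_i = c * g@_i.
Proof.
rewrite {2}[g]monalgE !raddf_sum mulr_sumr.
by apply: eq_bigr => j _ /=; rewrite !mcoeffU mulrnAr.
Qed.

Fact free_scaleA c d g : free_scale c (free_scale d g) = free_scale (c * d) g.
Proof. by apply/malgP => i; rewrite !free_scaleE mulrA. Qed.

Fact free_scale1 : left_id 1 free_scale.
Proof. by move=> g; apply/malgP => i; rewrite free_scaleE mul1r. Qed.

Fact free_scaleDr : right_distributive free_scale +%R.
Proof.
by move=> c g h; apply/malgP => i; rewrite mcoeffD !free_scaleE mcoeffD mulrDr.
Qed.

Fact free_scaleDl g : {morph free_scale^~ g : c d / c + d}.
Proof.
by move=> c d; apply/malgP => i; rewrite mcoeffD !free_scaleE mulrDl.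
Qed.

HB.instance Definition _ := GRing.Zmodule_isLmodule.Build R free_module
  free_scaleA free_scale1 free_scaleDr free_scaleDl.

Section Extend.
Variables (M : lmodType R) (f : K -> M).

Definition free_extend (g : free_module) : M := \sum_(i <- msupp g) g@_i *: f i.

Lemma free_extendw (d : {fset K}) (g : free_module) : (msupp g `<=` d)%fset ->
  free_extend g = \sum_(i <- d) g@_i *: f i.
Proof.
by move=> le; apply: big_fset_incl => // i _ /mcoeff_outdom ->; rewrite scale0r.
Qed.

Fact free_extend_linear : linear free_extend.
Proof.
move=> c g h; pose d := (msupp g `|` msupp h `|` msupp (c *: g + h)%R)%fset.
have gd : (msupp g `<=` d)%fset by rewrite /d -fsetUA fsubsetUl.
have hd : (msupp h `<=` d)%fset by rewrite /d fsetUAC fsubsetUr.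
rewrite (free_extendw gd) (free_extendw hd) (@free_extendw d) ?fsubsetUr //.
rewrite scaler_sumr -big_split; apply: eq_bigr => i _ /=.
by rewrite mcoeffD free_scaleE scalerDl scalerA.
Qed.
HB.instance Definition _ :=
  GRing.isLinear.Build R free_module M *:%R free_extend free_extend_linear.

Lemma free_extendU i : free_extend << i >> = f i.
Proof.
by rewrite (free_extendw msuppU_le) big_seq_fset1 mcoeffUU scale1r.
Qed.
End Extend.

Lemma free_extend_eq (M : lmodType R) (u : {linear free_module -> M}) g :
  u g = free_extend (fun i => u << i >>) g.
Proof.
rewrite {1}[g]monalgE raddf_sum; apply: eq_bigr => i _ /=.
rewrite -linearZ; congr (u _); apply/malgP => j.
by rewrite free_scaleE !mcoeffU mulrnAr mulr1.
Qed.

Lemma free_module_projective : projective free_module.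
Proof.
move=> M N f g f_surj; have [s fs] := choice (fun i => f_surj (g << i >>)).
exists (free_extend s) => p; rewrite [RHS]free_extend_eq /= raddf_sum.
by apply: eq_bigr => i _ /=; rewrite linearZ /= fs.
Qed.
End FreeModule.

Section KernelModule.
Variables (R : pzRingType) (M N : lmodType R) (f : {linear M -> N}).

Definition ker_pred : {pred M} := [pred x | f x == 0].

Fact ker_closed : submod_closed ker_pred.
Proof.
split=> [|a x y]; rewrite !inE ?raddf0 // => /eqP fx /eqP fy.
by rewrite linearP fx fy scaler0 addr0.
Qed.
HB.instance Definition _ := GRing.isSubmodClosed.Build R M ker_pred ker_closed.

Record ker_module := KerModule { ker_val : M; _ : ker_val \in ker_pred }.
HB.instance Definition _ := [isSub for ker_val].
HB.instance Definition _ := [Choice of ker_module by <:].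
HB.instance Definition _ := [SubChoice_isSubLmodule of ker_module by <:].
End KernelModule.

(* Every module has a projective resolution, by free modules: each syzygy is
   covered by the free module on its underlying set. *)
Section FreeResolution.
Variables (R : pzRingType) (N : lmodType R).

Definition free_cover (M : lmodType R) : {linear free_module R M -> M} :=
  free_extend (@id M).

Fixpoint syzygy n : lmodType R :=
  if n is m.+1 then ker_module (free_cover (syzygy m)) else N.

Definition free_diff n :
    {linear free_module R (syzygy n.+1) -> free_module R (syzygy n)} :=
  (val : syzygy n.+1 -> free_module R (syzygy n)) \o free_cover (syzygy n.+1).

Lemma free_cover_surj M y : exists x, free_cover M x = y.
Proof. by exists (<< y >> : free_module R M); exact: (free_extendU id). Qed.

Lemma free_cover_exact n x :
  free_cover (syzygy n) x = 0 <-> exists y, free_diff n y = x.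
Proof.
split=> [x0|[y <-]]; last first.
  by apply/eqP; exact: (valP (free_cover (syzygy n.+1) y : ker_module _)).
have kx : x \in ker_pred (free_cover (syzygy n)) by apply/eqP.
have [y yx] := @free_cover_surj (syzygy n.+1) (KerModule kx).
by exists y; rewrite /= yx.
Qed.

Lemma free_diff_exact n x :
  free_diff n x = 0 <-> exists y, free_diff n.+1 y = x.
Proof.
rewrite -free_cover_exact; split=> [/= x0|x0]; first exact: val_inj.
by rewrite /= x0.
Qed.

Definition free_resolution : projective_resolution N :=
  @ProjectiveResolution R N (fun n => free_module R (syzygy n)) free_diff
    (free_cover N) (fun n => @free_module_projective R (syzygy n))
    (free_cover_surj (M := N)) (@free_cover_exact 0) free_diff_exact.
End FreeResolution.

(* A module over the commutative ring k, seen as a right module; the alias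
   carries the k^c-module structure without overloading that of M. *)
Definition right_module (k : comPzRingType) (M : lmodType k) : Type := M.

Section RightModule.
Variables (k : comPzRingType) (M : lmodType k).
HB.instance Definition _ := GRing.Zmodule.on (right_module M).

Definition right_scale (a : k^c) (v : right_module M) : right_module M :=
  (a : k) *: (v : M).

Fact right_scaleA a b v : right_scale a (right_scale b v) = right_scale (a * b) v.
Proof. by rewrite /right_scale scalerA [(a : k) * _]mulrC. Qed.

HB.instance Definition _ := @GRing.Zmodule_isLmodule.Build k^c (right_module M)
  right_scale right_scaleA (@scale1r k M) (@scalerDr k M)
  (fun v a b => @scalerDl k M v a b).
End RightModule.

Section OppositeAlgebra.
Variables (k : comPzRingType) (A : algType k).

HB.instance Definition _ := GRing.Zmodule_isLmodule.Build k A^c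
  (@scalerA k A) (@scale1r k A) (@scalerDr k A) (fun v a b => @scalerDl k A v a b).
HB.instance Definition _ := GRing.Lmodule_isLalgebra.Build k A^c
  (fun a (u v : A^c) => scalerAr a (v : A) (u : A)).
HB.instance Definition _ := GRing.Lalgebra_isAlgebra.Build k A^c
  (fun a (u v : A^c) => scalerAl a (v : A) (u : A)).
End OppositeAlgebra.

(* The ring A (x)_k B, with (a (x) b)(a' (x) b') = aa' (x) bb'. It may be
   the zero ring when k is not a field, hence pzRingType. *)
Definition tensor_alg (k : comPzRingType) (A B : algType k) :=
  tensor (right_module A) B.
HB.instance Definition _ (k : comPzRingType) (A B : algType k) :=
  GRing.Zmodule.on (tensor_alg A B).

HB.lock Definition atens (k : comPzRingType) (A B : algType k) (a : A) (b : B) :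
  tensor_alg A B := tens (a : right_module A) b.
Arguments atens {k A B} a b.

HB.lock Definition tens_lmul (k : comPzRingType) (A B : algType k) (a : A) (b : B)
    (y : tensor_alg A B) : tensor_alg A B :=
  tens_lift (fun (a' : right_module A) b' => atens (a * a') (b * b')) y.
Arguments tens_lmul {k A B} a b y.

HB.lock Definition tens_mul (k : comPzRingType) (A B : algType k)
    (x y : tensor_alg A B) : tensor_alg A B :=
  tens_lift (fun (a : right_module A) b => tens_lmul a b y) x.
Arguments tens_mul {k A B} x y.

Section TensorAlgebra.
Variables (k : comPzRingType) (A B : algType k).
Implicit Types (x y z : tensor_alg A B).
Local Notation "a ⊗ b" := (@atens k A B a b) (at level 40).
Local Notation tens_lmul := (@tens_lmul k A B).
Local Notation tens_mul := (@tens_mul k A B).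

Lemma atensDl a a' b : (a + a') ⊗ b = a ⊗ b + a' ⊗ b.
Proof. by rewrite unlock; exact: tensDl. Qed.

Lemma atensDr a b b' : a ⊗ (b + b') = a ⊗ b + a ⊗ b'.
Proof. by rewrite unlock; exact: tensDr. Qed.

Lemma atensZ (c : k) a b : (c *: a) ⊗ b = a ⊗ (c *: b).
Proof. by rewrite unlock; exact: tensZ. Qed.

Lemma atens_ind (P : tensor_alg A B -> Prop) :
    P 0 -> (forall x y, P x -> P y -> P (x - y)) -> (forall a b, P (a ⊗ b)) ->
  forall x, P x.
Proof. by rewrite unlock => P0 PB Pt; exact: tens_ind. Qed.

Fact tens_lmul_balanced a b :
  balanced (fun (a' : right_module A) b' => (a * a') ⊗ (b * b')).
Proof.
split=> [a1 a2 b'|a' b1 b2|a' c b'].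
- by rewrite -atensDl -mulrDr.
- by rewrite -atensDr -mulrDr.
- by have := atensZ c (a * a') (b * b'); rewrite !scalerAr.
Qed.

Fact tens_lmulB a b : {morph tens_lmul a b : x y / x - y}.
Proof. by rewrite unlock; exact: tens_lift_zmod_morphism (tens_lmul_balanced a b). Qed.

Fact tens_lmul0 a b : tens_lmul a b 0 = 0.
Proof. by rewrite -(subrr 0) tens_lmulB !subrr. Qed.

Fact tens_lmulE a b a' b' : tens_lmul a b (a' ⊗ b') = (a * a') ⊗ (b * b').
Proof.
rewrite {1}atens.unlock tens_lmul.unlock.
exact: (tens_liftE (tens_lmul_balanced a b) a' b').
Qed.

Fact tens_mul_balanced y :
  balanced (fun (a : right_module A) (b : B) => tens_lmul a b y).
Proof.
have addB (u v w t : tensor_alg A B) : u + v - (w + t) = u - w + (v - t).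
  by rewrite opprD addrACA.
split=> [a1 a2 b|a b1 b2|a c b]; elim/atens_ind: y => [|y z hy hz|a' b'].
- by rewrite !tens_lmul0 addr0.
- by rewrite !tens_lmulB hy hz addB.
- by rewrite !tens_lmulE -atensDl -mulrDl.
- by rewrite !tens_lmul0 addr0.
- by rewrite !tens_lmulB hy hz addB.
- by rewrite !tens_lmulE -atensDr -mulrDl.
- by rewrite !tens_lmul0.
- by rewrite !tens_lmulB hy hz.
- by rewrite !tens_lmulE; have := atensZ c (a * a') (b * b'); rewrite !scalerAl.
Qed.

Lemma tens_mulBl y : {morph tens_mul^~ y : x z / x - z}.
Proof. by rewrite unlock; exact: tens_lift_zmod_morphism (tens_mul_balanced y). Qed.

Lemma tens_mul_pure a b y : tens_mul (a ⊗ b) y = tens_lmul a b y.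
Proof.
by rewrite atens.unlock tens_mul.unlock; exact: (tens_liftE (tens_mul_balanced y) a b).
Qed.

Lemma tens_mulE a b a' b' : tens_mul (a ⊗ b) (a' ⊗ b') = (a * a') ⊗ (b * b').
Proof. by rewrite tens_mul_pure tens_lmulE. Qed.

Lemma tens_mul0l y : tens_mul 0 y = 0.
Proof. by rewrite -(subrr 0) tens_mulBl !subrr. Qed.

Lemma tens_mulBr x : {morph tens_mul x : y z / y - z}.
Proof.
move=> y z; elim/atens_ind: x => [|u v hu hv|a b].
- by rewrite !tens_mul0l subr0.
- by rewrite !tens_mulBl hu hv !opprB addrACA [X in _ + X]addrC addrACA.
- by rewrite !tens_mul_pure tens_lmulB.
Qed.

Lemma tens_mul0r x : tens_mul x 0 = 0.
Proof. by rewrite -(subrr 0) tens_mulBr !subrr. Qed.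

Fact tens_mulDl : left_distributive tens_mul +%R.
Proof.
move=> x y z; rewrite -{1}[y]opprK tens_mulBl -[- y]sub0r tens_mulBl tens_mul0l.
by rewrite sub0r opprK.
Qed.

Fact tens_mulDr : right_distributive tens_mul +%R.
Proof.
move=> x y z; rewrite -{1}[z]opprK tens_mulBr -[- z]sub0r tens_mulBr tens_mul0r.
by rewrite sub0r opprK.
Qed.

Fact tens_mulA : associative tens_mul.
Proof.
elim/atens_ind=> [y z|u v hu hv y z|a b]; first by rewrite !tens_mul0l.
  by rewrite !tens_mulBl hu hv.
elim/atens_ind=> [z|u v hu hv z|a' b'].
- by rewrite tens_mul0l !tens_mul0r tens_mul0l.
- by rewrite !tens_mulBl !tens_mulBr hu hv tens_mulBl.
elim/atens_ind=> [|u v hu hv|c d]; first by rewrite !tens_mul0r.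
  by rewrite !tens_mulBr hu hv.
by rewrite !tens_mulE !mulrA.
Qed.

Fact tens_mul1l : left_id (1 ⊗ 1) tens_mul.
Proof.
elim/atens_ind=> [|u v hu hv|a b]; first exact: tens_mul0r.
  by rewrite tens_mulBr hu hv.
by rewrite tens_mulE !mul1r.
Qed.

Fact tens_mul1r : right_id (1 ⊗ 1) tens_mul.
Proof.
elim/atens_ind=> [|u v hu hv|a b]; first exact: tens_mul0l.
  by rewrite tens_mulBl hu hv.
by rewrite tens_mulE !mulr1.
Qed.

HB.instance Definition _ := GRing.Zmodule_isPzRing.Build (tensor_alg A B)
  tens_mulA tens_mul1l tens_mul1r tens_mulDl tens_mulDr.

Lemma atensM a b a' b' : (a ⊗ b) * (a' ⊗ b') = (a * a') ⊗ (b * b').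
Proof. exact: tens_mulE. Qed.

End TensorAlgebra.

Definition env (k : comPzRingType) (A : algType k) := tensor_alg A A^c.
HB.instance Definition _ (k : comPzRingType) (A : algType k) :=
  GRing.PzRing.on (env A).

(* A as a left and as a right module over A^e = A (x) A^op:
   (a (x) b) . c = a c b  and  c . (a (x) b) = b c a  (see act_lE, act_rE). *)
HB.lock Definition act_l (k : comPzRingType) (A : algType k) (x : env A) (c : A) : A :=
  tens_lift (fun (a : right_module A) (b : A^c) => (a : A) * c * (b : A)) x.
Arguments act_l {k A} x c.

HB.lock Definition act_r (k : comPzRingType) (A : algType k) (x : env A) (c : A) : A :=
  tens_lift (fun (a : right_module A) (b : A^c) => (b : A) * c * (a : A)) x.
Arguments act_r {k A} x c.

Section Hochschild.
Variables (k : comPzRingType) (A : algType k).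
Local Notation env := (env A).
Local Notation act_l := (@act_l k A).
Local Notation act_r := (@act_r k A).

Definition env_pure (a b : A) : env := atens a (b : A^c).
Local Notation "a ⊗ b" := (env_pure a b) (at level 40).

Fact act_l_balanced c :
  balanced (fun (a : right_module A) (b : A^c) => (a : A) * c * (b : A)).
Proof.
split=> [a a' b|a b b'|a r b]; first by rewrite !mulrDl.
- exact: mulrDr.
- by rewrite -[(r : k^c) *: a]/((r : k) *: (a : A)) -!scalerAl;
     rewrite -[r *: b]/((r : k) *: (b : A)) -scalerAr.
Qed.

Fact act_r_balanced c :
  balanced (fun (a : right_module A) (b : A^c) => (b : A) * c * (a : A)).
Proof.
split=> [a a' b|a b b'|a r b]; first exact: mulrDr.
- by rewrite -[b + b']/((b : A) + (b' : A)) !mulrDl.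
- by rewrite -[(r : k^c) *: a]/((r : k) *: (a : A)) -!scalerAr;
     rewrite -[r *: b]/((r : k) *: (b : A)) -!scalerAl.
Qed.

Lemma act_lE a b c : act_l (a ⊗ b) c = a * c * b.
Proof.
by rewrite /env_pure atens.unlock act_l.unlock; exact: (tens_liftE (act_l_balanced c) a b).
Qed.

Lemma act_rE a b c : act_r (a ⊗ b) c = b * c * a.
Proof.
by rewrite /env_pure atens.unlock act_r.unlock; exact: (tens_liftE (act_r_balanced c) a b).
Qed.

Fact act_lB c : {morph act_l^~ c : x y / x - y}.
Proof. by rewrite unlock; exact: tens_lift_zmod_morphism (act_l_balanced c). Qed.

Fact act_rB c : {morph act_r^~ c : x y / x - y}.
Proof. by rewrite unlock; exact: tens_lift_zmod_morphism (act_r_balanced c). Qed.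

Lemma env_ind (P : env -> Prop) :
    P 0 -> (forall x y, P x -> P y -> P (x - y)) -> (forall a b, P (a ⊗ b)) ->
  forall x, P x.
Proof. exact: atens_ind. Qed.

Lemma env_mulE a b a' b' : (a ⊗ b) * (a' ⊗ b') = (a * a') ⊗ (b' * b).
Proof. exact: tens_mulE. Qed.

Definition left_env_module : Type := A.
HB.instance Definition _ := GRing.Zmodule.on left_env_module.

Definition right_env_module : Type := A.
HB.instance Definition _ := GRing.Zmodule.on right_env_module.

Fact act_lBr x : {morph act_l x : c d / c - d}.
Proof.
move=> c d; elim/env_ind: x => [|x y hx hy|a b].
- by rewrite -(subrr 0) !act_lB !subrr.
- by rewrite !act_lB hx hy !opprB addrACA [X in _ + X]addrC addrACA.
- by rewrite !act_lE mulrBr mulrBl.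
Qed.

Fact act_rBr x : {morph act_r x : c d / c - d}.
Proof.
move=> c d; elim/env_ind: x => [|x y hx hy|a b].
- by rewrite -(subrr 0) !act_rB !subrr.
- by rewrite !act_rB hx hy !opprB addrACA [X in _ + X]addrC addrACA.
- by rewrite !act_rE mulrBr mulrBl.
Qed.

Fact act_lA x y c : act_l x (act_l y c) = act_l (x * y) c.
Proof.
elim/env_ind: x => [|x x' hx hx'|a b].
- by rewrite mul0r -(subrr 0) !act_lB !subrr.
- by rewrite mulrBl !act_lB hx hx'.
elim/env_ind: y => [|y y' hy hy'|a' b'].
- by rewrite mulr0 -(subrr 0) !act_lB act_lBr !subrr.
- by rewrite mulrBr !act_lB act_lBr hy hy'.
by rewrite env_mulE !act_lE !mulrA.
Qed.

Fact act_rA (x y : env^c) c : act_r x (act_r y c) = act_r (x * y) c.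
Proof.
rewrite -[x * y]/((y : env) * (x : env)).
elim/env_ind: x => [|x x' hx hx'|a b].
- by rewrite mulr0 -(subrr 0) !act_rB !subrr.
- by rewrite mulrBr !act_rB hx hx'.
elim/env_ind: y => [|y y' hy hy'|a' b'].
- by rewrite mul0r -(subrr 0) !act_rB act_rBr !subrr.
- by rewrite mulrBl !act_rB act_rBr hy hy'.
by rewrite env_mulE !act_rE !mulrA.
Qed.

Fact act_l1 : left_id 1 act_l.
Proof. by move=> c; rewrite -[1]/(1 ⊗ 1) act_lE mul1r mulr1. Qed.

Fact act_r1 : left_id 1 act_r.
Proof. by move=> c; rewrite -[1]/(1 ⊗ 1) act_rE mul1r mulr1. Qed.

Fact morphB_D (U V : zmodType) (f : U -> V) :
  {morph f : x y / x - y} -> {morph f : x y / x + y}.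
Proof.
move=> fB x y; have fN z : f (- z) = - f z.
  by rewrite -[- z]sub0r fB -[in f 0](subrr 0) fB subrr sub0r.
by rewrite -{1}[y]opprK fB fN opprK.
Qed.

HB.instance Definition _ :=
  GRing.Zmodule_isLmodule.Build env left_env_module act_lA act_l1
    (fun x => morphB_D (act_lBr x)) (fun c => morphB_D (act_lB c)).

HB.instance Definition _ :=
  GRing.Zmodule_isLmodule.Build env^c right_env_module act_rA act_r1
    (fun x => morphB_D (act_rBr x)) (fun c => morphB_D (act_rB c)).

(* HH_n(A) = Tor_n^{A^e}(A, A), with the second argument resolved by P. *)
Definition HH (P : projective_resolution left_env_module) (n : nat) : zmodType :=
  Tor right_env_module P n.
End Hochschild.

(* Main.v *)
Require Import Defs.
From HB Require Import structures.
From mathcomp Require Import all_boot all_algebra.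
From mathcomp Require Import generic_quotient ring_quotient.
From mathcomp Require Import boolp.
From mathcomp Require Import finmap monalg.

(* With u = x + y the relations of A read ux = xz = zy = 0, and the Koszul complex of
   A-bimodules has W_1 = <x, y, z>, W_2 = <ux, xz, zy>, W_3 = <uxz, xzy>, W_4 = <uxzy>.
   Fox derivatives of words contract it in degrees 0 and 1. In degrees n >= 2 the complex
   with coefficients in a bimodule M is exact as soon as, in M, ym = 0 implies m = 0,
   zm = 0 implies m in yM, and xm = 0 implies m in zM. These conditions hold for M = A^e,
   so that the complex resolves A, and for M = A, which gives HH_n(A) = 0 for n >= 2. *)

Set Implicit Arguments.
Unset Strict Implicit.
Unset Printing Implicit Defensive.

Import GRing.Theory.
Local Open Scope ring_scope.
Local Open Scope quotient_scope.

(** The three conditions on M say that the complex 0 -> M -> M -> M -> M of left multiplications by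
    y, z and x is exact. Right multiplications enter only through vanishing products of letters. For
    M = A the conditions need a division by letters, hence a linear section of the evaluation of
    words in A. A is given only as a quotient, so the section is obtained by letting A act on the
    span of all words and applying elements to the empty word. The division is then kept as a system
    of identities, a contracting homotopy of the complex above, because identities pass from A to
    A^e by acting on one tensor factor. The section is linear but not multiplicative. The Fox
    derivative of a normal form therefore obeys the Leibniz rule only up to a correction for each
    rewriting rule, and exactness in degree 1 amounts to each correction being a boundary. Since the
    resolution in the statement is arbitrary, vanishing is carried over to it from the Koszul
    resolution by a comparison of resolutions. *)

(** * Comparison of projective resolutions *)

Section Corestriction.
Variables (R : pzRingType) (U M N : lmodType R).
Variables (f : {linear M -> N}) (g : {linear U -> M}).
Hypothesis fg0 : forall u, f (g u) = 0.

Fact corestrict_subproof u : g u \in ker_pred f.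
Proof. by apply/eqP. Qed.

Definition corestrict u : ker_module f := KerModule (corestrict_subproof u).

Fact corestrict_linear : linear corestrict.
Proof. by move=> a u v; apply: val_inj; rewrite /= linearP. Qed.
HB.instance Definition _ := GRing.isLinear.Build R U (ker_module f) *:%R corestrict
  corestrict_linear.
End Corestriction.

(** Projectivity lifts through surjections only; exactness at Y makes X surject onto the kernel of
    [d], and [g] is lifted through that corestriction. *)
Lemma projective_lift (R : pzRingType) (P X Y Z : lmodType R)
    (d' : {linear X -> Y}) (d : {linear Y -> Z}) (g : {linear P -> Y}) :
    projective P ->
    (forall y, d y = 0 <-> exists x, d' x = y) -> (forall p, d (g p) = 0) ->
  exists h : {linear P -> X}, forall p, d' (h p) = g p.
Proof.
move=> projP exd dg0.
have dd0 x : d (d' x) = 0 by apply/exd; exists x.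
have surj (y : ker_module d) : exists x, corestrict dd0 x = y.
  have /exd[x xy] : d (val y) = 0 by apply/eqP; exact: (valP y).
  by exists x; apply: val_inj.
have [h hg] := projP _ _ (corestrict dd0) (corestrict dg0) surj.
by exists h => p; have /(congr1 val) := hg p.
Qed.

Lemma tens_ext (R : pzRingType) (M : lmodType R^c) (X : lmodType R) (V : zmodType)
    (f g : {additive tensor M X -> V}) :
  (forall m x, f (tens m x) = g (tens m x)) -> f =1 g.
Proof.
move=> fg; elim/tens_ind=> [|u v fgu fgv|//]; first by rewrite !raddf0.
by rewrite !raddfB fgu fgv.
Qed.

Section TensorMapTheory.
Variables (R : pzRingType) (M : lmodType R^c) (X Y : lmodType R) (g : {linear X -> Y}).

Lemma tens_map_eq0 (t : tensor M X) : t = 0 -> tens_map M g t = 0.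
Proof. by move->; exact: raddf0. Qed.

Lemma tens_mapB t u : tens_map M g (t - u) = tens_map M g t - tens_map M g u.
Proof. exact: raddfB. Qed.
End TensorMapTheory.

Section Comparison.
Variables (R : pzRingType) (N : lmodType R).
Implicit Types P Q : projective_resolution N.

(** Cycles in degree 0 are those of the augmentation, so that exactness of a resolution is one
    uniform statement over all degrees. *)
Definition res_cycle P n : P n -> Prop :=
  match n with
  | 0 => fun x => res_aug P x = 0
  | m.+1 => fun x => res_diff P m x = 0
  end.

Lemma res_cycleP P n (x : P n) : res_cycle x <-> exists y, res_diff P n y = x.
Proof. by case: n x => [|n] x; [exact: res_exact0|exact: res_exactS]. Qed.

Lemma res_diffK P n (x : P n.+1) : res_cycle (res_diff P n x).
Proof. by apply/res_cycleP; exists x. Qed.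

Lemma res_lift P Q m n (g : {linear P m -> Q n}) :
    (forall p, res_cycle (g p)) ->
  exists h : {linear P m -> Q n.+1}, forall p, res_diff Q n (h p) = g p.
Proof.
case: n g => [|n] g gZ.
  exact: (projective_lift (@res_projective _ _ P m) (@res_exact0 _ _ Q) gZ).
exact: (projective_lift (@res_projective _ _ P m) (@res_exactS _ _ Q n) gZ).
Qed.

Definition preserves_cycles P Q n (f : {linear P n -> Q n}) :=
  forall x, res_cycle x -> res_cycle (f x).

Lemma chain_map_step P Q n (f : {linear P n -> Q n}) : preserves_cycles f ->
  exists g : {linear P n.+1 -> Q n.+1},
    preserves_cycles g /\ forall x, res_diff Q n (g x) = f (res_diff P n x).
Proof.
move=> fZ; have fdZ x : res_cycle ((f \o res_diff P n) x) by exact/fZ/res_diffK.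
have [g gE] := res_lift fdZ; exists g; split=> // x x0.
by rewrite /= gE /= x0 raddf0.
Qed.

Lemma chain_map_exists P Q : exists f : forall n, {linear P n -> Q n},
  (forall x, res_aug Q (f 0%N x) = res_aug P x) /\
  (forall n x, res_diff Q n (f n.+1 x) = f n (res_diff P n x)).
Proof.
have [f0 f0E] := @res_projective _ _ P 0%N _ _ (res_aug Q) (res_aug P) (@res_aug_surj _ _ Q).
have f0Z : preserves_cycles f0 by move=> x /= x0; rewrite f0E.
(* Each map is carried together with the preservation of cycles that the next lift requires; [cid]
   chooses the lift. *)
pose next n (s : {f : {linear P n -> Q n} | preserves_cycles f}) :
    {f : {linear P n.+1 -> Q n.+1} | preserves_cycles f} :=
  let: exist g gP := cid (chain_map_step (svalP s)) in exist _ g gP.1.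
pose F := nat_rect (fun n => {f : {linear P n -> Q n} | preserves_cycles f})
  (exist _ f0 f0Z) next.
exists (fun n => sval (F n)); split=> // n x /=.
by rewrite /next; case: cid => g [].
Qed.

(** One degree of homology sees only two consecutive components of a homotopy, so no coherent family
    is built. The induction keeps the identity on boundaries alone, where the term containing the
    preceding component vanishes. *)
Lemma homotopy_exists P Q (f : forall n, {linear P n -> Q n}) :
    (forall x, res_aug Q (f 0%N x) = 0) ->
    (forall n x, res_diff Q n (f n.+1 x) = f n (res_diff P n x)) ->
  forall n, exists (s : {linear P n -> Q n.+1}) (t : {linear P n.+1 -> Q n.+2}),
    forall x, f n.+1 x = res_diff Q n.+1 (t x) + s (res_diff P n x).
Proof.
move=> f0 fd n.
suff: exists s : {linear P n -> Q n.+1},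
    forall x, f n (res_diff P n x) = res_diff Q n (s (res_diff P n x)).
  case=> s sE; exists s.
  pose g : {linear P n.+1 -> Q n.+1} := f n.+1 \- (s \o res_diff P n).
  have gZ x : res_cycle (g x) by rewrite /= raddfB /= fd sE subrr.
  have [t tE] := res_lift gZ; exists t => x.
  by rewrite tE /= subrK.
elim: n => [|n [s sE]].
  have [s sE] := res_lift (f0 : forall x, res_cycle (f 0%N x)).
  by exists s => x; rewrite sE.
pose g : {linear P n.+1 -> Q n.+1} := f n.+1 \- (s \o res_diff P n).
have gZ x : res_cycle (g x) by rewrite /= raddfB /= fd sE subrr.
have [t tE] := res_lift gZ; exists t => x.
by rewrite tE /= (res_diffK x) raddf0 subr0.
Qed.

(** The index is that of the outgoing differential: exactness is meant in degree n + 1. *)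
Definition Tor_exact (M : lmodType R^c) P n := forall t,
  tens_map M (res_diff P n) t = 0 ->
  exists t', tens_map M (res_diff P n.+1) t' = t.

Lemma Tor_exact_comparison (M : lmodType R^c) P Q n :
  Tor_exact M Q n -> Tor_exact M P n.
Proof.
move=> exQ t t0.
have [f [faug fd]] := chain_map_exists P Q.
have [g [gaug gd]] := chain_map_exists Q P.
pose e i : {linear P i -> P i} := (g i \o f i) \- idfun.
have e0 x : res_aug P (e 0%N x) = 0 by rewrite /= raddfB /= gaug faug subrr.
have ed i x : res_diff P i (e i.+1 x) = e i (res_diff P i x).
  by rewrite /= raddfB /= gd fd.
have [s [s' sE]] := homotopy_exists e0 ed n.
have gfE : tens_map M (g n.+1) (tens_map M (f n.+1) t)
    = t + (tens_map M (res_diff P n.+1) (tens_map M s' t)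
           + tens_map M s (tens_map M (res_diff P n) t)).
  move: {t0} t; apply: (tens_ext (f := tens_map M (g n.+1) \o tens_map M (f n.+1))
    (g := idfun \+ ((tens_map M (res_diff P n.+1) \o tens_map M s')
           \+ (tens_map M s \o tens_map M (res_diff P n))))) => m x /=.
  by rewrite !tens_mapE -!tensDr -sE /= addrC subrK.
have natE (L L' : projective_resolution N) (h : forall i, {linear L i -> L' i}) :
    (forall i x, res_diff L' i (h i.+1 x) = h i (res_diff L i x)) -> forall i u,
  tens_map M (res_diff L' i) (tens_map M (h i.+1) u)
    = tens_map M (h i) (tens_map M (res_diff L i) u).
  move=> hd i; apply: (tens_ext (f := tens_map M (res_diff L' i) \o tens_map M (h i.+1))
    (g := tens_map M (h i) \o tens_map M (res_diff L i))) => m x /=.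
  by rewrite !tens_mapE hd.
have [|w wE] := exQ (tens_map M (f n.+1) t).
  by rewrite natE //; exact: tens_map_eq0.
(* With d w = f t, the image g w has boundary g f t = t + d s' t, because t is a cycle; subtracting
   s' t leaves t. *)
exists (tens_map M (g n.+2) w - tens_map M s' t).
rewrite tens_mapB natE // wE gfE (tens_map_eq0 s t0) addr0.
by rewrite addrK.
Qed.
End Comparison.

Lemma homology_eq0 (X Y Z : zmodType) (d' : {additive X -> Y}) (d : {additive Y -> Z}) :
    (forall y, d y = 0 -> exists x, d' x = y) ->
  forall h : homology d' d, h = 0.
Proof.
move=> exd h; rewrite -[h]reprK -(raddf0 (\pi_(Quotient.quot (@boundaries _ _ _ d' d)))).
apply/eqP; rewrite -Quotient.idealrBE subr0; apply/asboolP/exd/eqP.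
exact: (valP (repr (h : Quotient.quot (@boundaries _ _ _ d' d)))).
Qed.

(** * Free modules of rows and their tensor products *)

Section RowModules.
Variable R : pzRingType.

Lemma row_projective n : projective 'rV[R]_n.
Proof.
move=> M N f g f_surj; have [s fs] := choice (fun i => f_surj (g (delta_mx 0 i))).
pose h (v : 'rV[R]_n) : M := \sum_i v 0 i *: s i.
have h_linear : linear h.
  move=> a u v; rewrite /h scaler_sumr -big_split; apply: eq_bigr => i _ /=.
  by rewrite !mxE scalerDl scalerA.
pose H := GRing.isLinear.Build R 'rV[R]_n M *:%R h h_linear.
pose hL : {linear 'rV[R]_n -> M} := HB.pack h H.
exists hL => v; rewrite /= /h raddf_sum [in RHS](row_sum_delta v) raddf_sum.
by apply: eq_bigr => i _ /=; rewrite !linearZ /= fs.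
Qed.

Section RowMul.
Variables (p q : nat) (D : 'M[R]_(p, q)).

Definition mulmx_row_map (v : 'rV[R]_p) : 'rV[R]_q := v *m D.

Fact mulmx_row_map_linear : linear mulmx_row_map.
Proof. by move=> a u v; rewrite /mulmx_row_map mulmxDl scalemxAl. Qed.
HB.instance Definition _ := GRing.isLinear.Build R 'rV[R]_p 'rV[R]_q *:%R mulmx_row_map
  mulmx_row_map_linear.
End RowMul.

Section RightAction.
Variable M : lmodType R^c.
Implicit Types (r s : R) (m : M).

Definition ract r m : M := (r : R^c) *: m.

Lemma ractM r s m : ract s (ract r m) = ract (r * s) m.
Proof. exact: (@scalerA R^c M s r m). Qed.

Lemma ractDr r m m' : ract r (m + m') = ract r m + ract r m'.
Proof. exact: scalerDr. Qed.

Lemma ractNr r m : ract r (- m) = - ract r m.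
Proof. exact: scalerN. Qed.

Lemma ract0r r : ract r 0 = 0 :> M.
Proof. exact: scaler0. Qed.

Lemma ract0l m : ract 0 m = 0.
Proof. exact: scale0r. Qed.

Lemma ractDl r s m : ract (r + s) m = ract r m + ract s m.
Proof. exact: (@scalerDl R^c M m r s). Qed.

Lemma ractNl r m : ract (- r) m = - ract r m.
Proof. exact: (@scaleNr R^c M r m). Qed.
End RightAction.

(** This is what the map v -> v D becomes after tensoring with M, under the identification of M ⊗
    R^p with M^p. *)
Definition row_act (M : lmodType R^c) p q (m : 'I_p -> M) (D : 'M[R]_(p, q)) (j : 'I_q) : M :=
  \sum_i ract (D i j) (m i).

Definition row_exact (M : lmodType R^c) p q r (D' : 'M[R]_(p, q)) (D : 'M[R]_(q, r)) :=
  forall m : 'I_q -> M, (forall j, row_act m D j = 0) ->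
  exists m' : 'I_p -> M, forall i, row_act m' D' i = m i.

Section TensorRow.
Variable M : lmodType R^c.

(** The coordinates of the isomorphism from M ⊗ R^q to M^q, whose inverse is [tens_row]. *)
Definition tens_coord q (i : 'I_q) : tensor M 'rV[R]_q -> M :=
  tens_lift (fun m (v : 'rV[R]_q) => (v 0 i : R^c) *: m).

Fact tens_coord_balanced q (i : 'I_q) :
  balanced (fun (m : M) (v : 'rV[R]_q) => (v 0 i : R^c) *: m).
Proof.
split=> [m m' v|m v v'|m r v]; first exact: scalerDr.
- by rewrite mxE -scalerDl.
- by rewrite mxE scalerA.
Qed.

Fact tens_coord_zmod_morphism q (i : 'I_q) : zmod_morphism (tens_coord i).
Proof. exact: tens_lift_zmod_morphism (tens_coord_balanced i). Qed.
HB.instance Definition _ q (i : 'I_q) :=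
  GRing.isZmodMorphism.Build _ _ (tens_coord i) (tens_coord_zmod_morphism i).

Lemma tens_coordE q (i : 'I_q) m v : tens_coord i (tens m v) = (v 0 i : R^c) *: m.
Proof. exact: (tens_liftE (tens_coord_balanced i)). Qed.

Definition tens_row q (m : 'I_q -> M) : tensor M 'rV[R]_q :=
  \sum_i tens (m i) (delta_mx 0 i).

Fact tensl_zmod_morphism (N : lmodType R) (n : N) :
  zmod_morphism (fun m : M => tens m n).
Proof. by move=> m m'; apply/eqP; rewrite eq_sym subr_eq -tensDl subrK. Qed.

Fact tensr_zmod_morphism (N : lmodType R) (m : M) :
  zmod_morphism (fun n : N => tens m n).
Proof. by move=> n n'; apply/eqP; rewrite eq_sym subr_eq -tensDr subrK. Qed.

Lemma tens_rowE q m (v : 'rV[R]_q) : tens_row (fun i => (v 0 i : R^c) *: m) = tens m v.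
Proof.
pose tm : {additive 'rV[R]_q -> tensor M 'rV[R]_q} :=
  HB.pack (tens m) (GRing.isZmodMorphism.Build _ _ _ (tensr_zmod_morphism (N := 'rV[R]_q) m)).
rewrite -[tens m v]/(tm v) [in RHS](row_sum_delta v) raddf_sum.
by apply: eq_bigr => i _; rewrite tensZ.
Qed.

Lemma tens_coordK q (t : tensor M 'rV[R]_q) : tens_row (fun i => tens_coord i t) = t.
Proof.
elim/tens_ind: t => [|u v hu hv|m v].
- by rewrite /tens_row big1 // => i _; rewrite raddf0; apply/eqP;
    rewrite -(subrr (0 : M)) tensl_zmod_morphism subrr.
- rewrite -[in RHS]hu -[in RHS]hv /tens_row -sumrB; apply: eq_bigr => i _.
  by rewrite raddfB tensl_zmod_morphism.
- by rewrite -[RHS]tens_rowE; apply: eq_bigr => i _; rewrite tens_coordE.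
Qed.

Lemma tens_coord_row q (m : 'I_q -> M) j : tens_coord j (tens_row m) = m j.
Proof.
transitivity (\sum_i ((delta_mx 0 i : 'rV[R]_q) 0 j : R^c) *: m i).
  rewrite -[LHS]/(tens_coord j (\sum_i tens (m i) (delta_mx 0 i : 'rV[R]_q))).
  by rewrite (raddf_sum (tens_coord j)); apply: eq_bigr => i _; exact: tens_coordE.
rewrite (bigD1 j) //= mxE !eqxx scale1r big1 ?addr0 // => i ij.
by rewrite mxE [j == i]eq_sym (negPf ij) andbF scale0r.
Qed.

Lemma tens_coord_map p q (D : 'M[R]_(p, q)) t j :
  tens_coord j (tens_map M (mulmx_row_map D) t) = row_act (fun i => tens_coord i t) D j.
Proof.
elim/tens_ind: t => [|u v hu hv|m v].
- rewrite (tens_map_eq0 _ erefl) /row_act raddf0 big1 // => i _.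
  by rewrite raddf0 ract0r.
- rewrite tens_mapB !raddfB /= hu hv /row_act -sumrB; apply: eq_bigr => i _.
  by rewrite raddfB ractDr ractNr.
- rewrite tens_mapE tens_coordE mxE /row_act scaler_suml.
  by apply: eq_bigr => i _; rewrite tens_coordE /ract scalerA.
Qed.

Lemma row_exact_tens p q r (D' : 'M[R]_(p, q)) (D : 'M[R]_(q, r)) (t : tensor M 'rV[R]_q) :
    row_exact M D' D -> tens_map M (mulmx_row_map D) t = 0 ->
  exists t', tens_map M (mulmx_row_map D') t' = t.
Proof.
move=> exD t0; have [j|m' m'E] := exD (fun i => tens_coord i t).
  by rewrite -tens_coord_map t0 raddf0.
exists (tens_row m'); rewrite -[LHS]tens_coordK -[RHS]tens_coordK; congr tens_row.
apply: funext => i; rewrite tens_coord_map -m'E /row_act.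
by apply: eq_bigr => l _; rewrite tens_coord_row.
Qed.
End TensorRow.

(** Over the regular right module, [row_act] is the matrix product itself, so one criterion on
    coefficients serves both for the resolution and for its tensor product with A. *)
Lemma row_exact_regular p q r (D' : 'M[R]_(p, q)) (D : 'M[R]_(q, r)) (v : 'rV[R]_q) :
    row_exact (R^c)^o D' D -> v *m D = 0 -> exists v', v' *m D' = v.
Proof.
move=> exD v0; have [j|m' m'E] := exD (v 0).
  by have /matrixP/(_ 0 j) := v0; rewrite !mxE.
exists (\row_i m' i); apply/rowP => i; rewrite -m'E mxE.
by apply: eq_bigr => l _; rewrite mxE.
Qed.
End RowModules.

Lemma free_module_ext (R : pzRingType) (K : choiceType) (M : lmodType R)
    (f g : {linear free_module R K -> M}) :
  (forall i, f << i >> = g << i >>) -> f =1 g.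
Proof.
by move=> fg u; rewrite free_extend_eq [RHS]free_extend_eq; apply: eq_bigr => i _; rewrite fg.
Qed.

(** * Normal forms in A and division by letters *)

Section NormalForms.
Variable k : fieldType.
Local Notation A := (algA k).
Local Notation V := (free_module k (seq nat)).
Local Notation word w := (<< w >> : V).

Definition letter (i : nat) : A := alg_quot_pi (@relations k) (gen k i).

Lemma letter_xx_yx : letter 0 * letter 0 + letter 1 * letter 0 = 0.
Proof.
rewrite !alg_quot_mulE -alg_quot_piD -(alg_quot_pi0 (@relations k)) -expr2.
by apply/alg_quot_pi_eq; rewrite subr0; apply/ideal_gen/rel_xx_yx.
Qed.

Lemma letter_xz : letter 0 * letter 2 = 0.
Proof.
rewrite alg_quot_mulE -(alg_quot_pi0 (@relations k)).
by apply/alg_quot_pi_eq; rewrite subr0; apply/ideal_gen/rel_xz.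
Qed.

Lemma letter_zy : letter 2 * letter 1 = 0.
Proof.
rewrite alg_quot_mulE -(alg_quot_pi0 (@relations k)).
by apply/alg_quot_pi_eq; rewrite subr0; apply/ideal_gen/rel_zy.
Qed.

Lemma letter_yx : letter 1 * letter 0 = - (letter 0 * letter 0).
Proof. by apply/eqP; rewrite -addr_eq0 addrC letter_xx_yx. Qed.

(** The overlap zyx of zy = 0 and yx = -xx produces this cubic relation, the one element of the
    Groebner basis that is not a defining relation. *)
Lemma letter_zxx : letter 2 * (letter 0 * letter 0) = 0.
Proof. by rewrite -[_ * letter 0]opprK -letter_yx mulrN mulrA letter_zy mul0r oppr0. Qed.

(* Left multiplication by a letter in the Groebner basis yx = -xx, xz = 0, zy = 0,
   zxx = 0. It is defined on all words, normal or not, and satisfies the relations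
   of A on all of them, so that A acts on the span of all words. *)
Definition letter_step (i : nat) (w : seq nat) : V :=
  match i, w with
  | 0, 2 :: _ => 0
  | 1, 0 :: _ => - << 0 :: w >>
  | 2, 1 :: _ => 0
  | 2, 0 :: 0 :: _ => 0
  | _, _ => << i :: w >>
  end.

Definition letter_act i : {linear V -> V} := free_extend (letter_step i).

Lemma letter_actE i w : letter_act i (word w) = letter_step i w.
Proof. exact: free_extendU. Qed.

Definition eval_word (w : seq nat) : A := \prod_(i <- w) letter i.

Definition eval : {linear V -> A} := free_extend eval_word.

Lemma evalE w : eval (word w) = eval_word w.
Proof. exact: free_extendU. Qed.

Lemma eval_word_cons i w : eval_word (i :: w) = letter i * eval_word w.
Proof. exact: big_cons. Qed.

Lemma letter_act_xz v : letter_act 0 (letter_act 2 v) = 0.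
Proof.
pose f : {linear V -> V} := letter_act 0 \o letter_act 2.
suff: f =1 \0 by exact.
apply: free_module_ext => w.
rewrite -[LHS]/(letter_act 0 (letter_act 2 (word w))) letter_actE.
by case: w => [|[|[|i]] [|[|j] w]]; rewrite ?linear0 ?letter_actE.
Qed.

Lemma letter_act_zy v : letter_act 2 (letter_act 1 v) = 0.
Proof.
pose f : {linear V -> V} := letter_act 2 \o letter_act 1.
suff: f =1 \0 by exact.
apply: free_module_ext => w.
rewrite -[LHS]/(letter_act 2 (letter_act 1 (word w))) letter_actE.
by case: w => [|[|i] w]; rewrite [letter_step _ _]/= ?linearN letter_actE
  ?oppr0.
Qed.

Lemma letter_act_xx_yx v :
  letter_act 0 (letter_act 0 v) + letter_act 1 (letter_act 0 v) = 0.
Proof.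
pose f : {linear V -> V} :=
  (letter_act 0 \o letter_act 0) \+ (letter_act 1 \o letter_act 0).
suff: f =1 \0 by exact.
apply: free_module_ext => w.
rewrite -[LHS]/(letter_act 0 (letter_act 0 (word w)) + letter_act 1 (letter_act 0 (word w))).
rewrite letter_actE.
by case: w => [|[|[|[|i]]] w]; rewrite [letter_step _ _]/= ?linear0 ?addr0 ?letter_actE //= subrr.
Qed.

Lemma eval_letter_step i w : eval (letter_step i w) = letter i * eval_word w.
Proof.
case: i => [|[|[|i]]].
- case: w => [|[|[|[|j]]] w]; rewrite [letter_step _ _]/= ?evalE ?eval_word_cons ?linear0;
    try reflexivity.
  by rewrite mulrA letter_xz mul0r.
- case: w => [|[|j] w]; rewrite [letter_step _ _]/= ?linearN ?evalE ?eval_word_cons;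
    try reflexivity.
  by rewrite !mulrA letter_yx mulNr.
- case: w => [|[|[|j]] w]; rewrite ?[letter_step _ (_.+1 :: _)]/= ?linear0 ?evalE ?eval_word_cons;
    try reflexivity.
    case: w => [|[|j] w]; rewrite [letter_step _ _]/= ?linear0 ?evalE ?eval_word_cons;
      try reflexivity.
    by rewrite [letter 0 * _]mulrA mulrA letter_zxx mul0r.
  by rewrite mulrA letter_zy mul0r.
- by rewrite [letter_step _ _]/= evalE eval_word_cons.
Qed.

Lemma eval_letter_act i v : eval (letter_act i v) = letter i * eval v.
Proof.
pose g : {linear V -> A} := letter i \*o eval.
suff: (eval \o letter_act i) =1 g by exact.
apply: free_module_ext => w; rewrite -[LHS]/(eval (letter_act i (word w))) letter_actE.
rewrite -[RHS]/(letter i * eval (word w)) evalE.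
exact: eval_letter_step.
Qed.

Definition word_act (s : seq 'I_3) (v : V) : V := foldr (fun i : 'I_3 => letter_act i) v s.

Lemma word_act_cat s t v : word_act (s ++ t) v = word_act s (word_act t v).
Proof. exact: foldr_cat. Qed.

Fact word_act_linear s : linear (word_act s).
Proof.
elim: s => [//|i s IHs] c u v.
by rewrite -[LHS]/(letter_act i (word_act s (c *: u + v))) IHs linearP.
Qed.
HB.instance Definition _ s := GRing.isLinear.Build k V V *:%R (word_act s) (word_act_linear s).

Definition free_act (v : V) : {linear free_module k {fmonom 'I_3} -> V} :=
  free_extend (fun m : {fmonom 'I_3} => word_act m v).

Lemma free_actU v c m : free_act v (<< c *g m >> : free_module k _) = c *: word_act m v.
Proof.
by rewrite -[LHS]/(free_extend _ _) (free_extendw _ msuppU_le) big_seq_fset1 mcoeffUU.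
Qed.

Lemma free_actE v (g : free3 k) : free_act v g = \sum_(m <- msupp g) g@_m *: word_act m v.
Proof. by []. Qed.

Lemma free_actB v (g h : free3 k) : free_act v (g - h) = free_act v g - free_act v h.
Proof. exact: (linearB (free_act v)). Qed.

Lemma free_actM v (g h : free3 k) : free_act v (g * h) = free_act (free_act v h) g.
Proof.
rewrite malgME.
transitivity (\sum_(m <- msupp g) \sum_(m' <- msupp h) (g@_m * h@_m') *: word_act (mmul m m') v).
  rewrite (linear_sum (free_act v)); apply: eq_bigr => m _.
  by rewrite (linear_sum (free_act v)); apply: eq_bigr => m' _; exact: free_actU.
rewrite [RHS]free_actE; apply: eq_bigr => m _.
rewrite free_actE linear_sum scaler_sumr; apply: eq_bigr => m' _.
by rewrite fmM word_act_cat linearZ scalerA.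
Qed.

Lemma free_act_gen v i : (i < 3)%N -> free_act v (gen k i) = letter_act i v.
Proof. by move=> i3; rewrite [LHS]free_actU scale1r fmuE /= inordK. Qed.

Lemma free_actD v (g h : free3 k) : free_act v (g + h) = free_act v g + free_act v h.
Proof. exact: (linearD (free_act v)). Qed.

Lemma free_act0 (g : free3 k) : free_act 0 g = 0.
Proof. by rewrite free_actE big1 // => m _; rewrite linear0 scaler0. Qed.

(** The vector [v] varies in the induction, since a right factor of an element of the ideal acts on
    it before that element does. This is why the relations must hold on all words. *)
Lemma free_act_ideal u v : in_ideal (@relations k) u -> free_act v u = 0.
Proof.
move=> uI; elim: uI v => {u} [r rel_r|v|u w _ hu _ hw v|r u _ hu v|r u _ hu v].
- have actM i j w : (i < 3)%N -> (j < 3)%N ->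
      free_act w (gen k i * gen k j) = letter_act i (letter_act j w).
    by move=> i3 j3; rewrite free_actM (free_act_gen _ i3) (free_act_gen _ j3).
  case: rel_r => v; last 2 first.
  + by rewrite actM // letter_act_xz.
  + by rewrite actM // letter_act_zy.
  rewrite -(letter_act_xx_yx v) -(actM 0) // -(actM 1) //.
  exact: free_actD.
- exact: (linear0 (free_act v)).
- by rewrite free_actB hu hw subrr.
- by rewrite free_actM hu free_act0.
- by rewrite free_actM hu.
Qed.

(** Applying [a] to the empty word gives a section of [eval]. It is independent of the
    representative because the ideal acts by zero, a fact that takes the place of a confluence
    argument. *)
Definition normal_form (a : A) : V := free_act (word [::]) (repr a : free3 k).

Lemma normal_form_pi (g : free3 k) :
  normal_form (alg_quot_pi (@relations k) g) = free_act (word [::]) g.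
Proof.
apply/eqP; rewrite -subr_eq0 -free_actB; apply/eqP/free_act_ideal.
exact: in_ideal_repr.
Qed.

Fact normal_form_linear : linear normal_form.
Proof.
move=> c; elim/alg_quotW=> g; elim/alg_quotW=> h.
rewrite -[X in normal_form X]/(c *: alg_quot_pi (@relations k) g + alg_quot_pi (@relations k) h).
rewrite alg_quot_scaleE -alg_quot_piD !normal_form_pi free_actD; congr (_ + _).
by rewrite -linearZ.
Qed.
HB.instance Definition _ := GRing.isLinear.Build k A V *:%R normal_form normal_form_linear.

Lemma normal_form_letter i a : (i < 3)%N ->
  normal_form (letter i * a) = letter_act i (normal_form a).
Proof.
move=> i3; elim/alg_quotW: a => g.
by rewrite /letter alg_quot_mulE !normal_form_pi free_actM free_act_gen.
Qed.

Lemma eval_free_act v (g : free3 k) :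
  eval (free_act v g) = alg_quot_pi (@relations k) g * eval v.
Proof.
have eval_mon (m : {fmonom 'I_3}) :
    eval (word_act m v) = alg_quot_pi (@relations k) (<< m >> : free3 k) * eval v.
  case: m => s; rewrite -[X in word_act X]/s.
  elim: s => [|i s IHs].
    have -> : (<< FMonom [::] >> : free3 k) = 1 by rewrite -fmoneE.
    by rewrite mul1r.
  have -> : (<< FMonom (i :: s) >> : free3 k) = gen k i * << FMonom s >>.
    by rewrite /gen inord_val malgM_def fgmulUU mul1r -[mmul _ _]/(fmmul _ _) fmmulE fmuE.
  by rewrite -alg_quot_mulE -mulrA -IHs -eval_letter_act.
rewrite free_actE [in RHS](monalgE g) (big_morph _ (@alg_quot_piD _ _ (@relations k))
  (@alg_quot_pi0 _ _ (@relations k))) mulr_suml (linear_sum eval).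
apply: eq_bigr => m _; rewrite linearZ /= eval_mon scalerAl alg_quot_scaleE.
congr (alg_quot_pi _ _ * _); apply/malgP => m'.
by rewrite [RHS]mcoeffU [LHS]mcoeffZ [X in _ * X]mcoeffU mulrnAr mulr1.
Qed.

Lemma eval_normal_form a : eval (normal_form a) = a.
Proof.
elim/alg_quotW: a => g; rewrite normal_form_pi eval_free_act evalE.
by rewrite /eval_word big_nil mulr1.
Qed.

(* Since za = 0 forces a in yA and xa = 0 forces a in zA, these are the coefficients of
   a one-sided division with remainder; the words y w and -xx w are y-multiples. *)
Definition strip_letter (i : nat) (w : seq nat) : V :=
  match i, w with
  | 0, 0 :: w' => << w' >>
  | 1, 1 :: w' => << w' >>
  | 1, 0 :: 0 :: w' => - << 0 :: w' >>
  | 2, 2 :: w' => << w' >>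
  | _, _ => 0
  end.

Definition strip i : {linear V -> V} := free_extend (strip_letter i).

Lemma stripE i w : strip i (word w) = strip_letter i w.
Proof. exact: free_extendU. Qed.

Lemma strip_act_y v : strip 1 (letter_act 1 v) = v.
Proof.
pose f : {linear V -> V} := strip 1 \o letter_act 1.
suff: f =1 idfun by exact.
apply: free_module_ext => w.
rewrite -[LHS]/(strip 1 (letter_act 1 (word w))) letter_actE.
by case: w => [|[|i] w]; rewrite [letter_step _ _]/= ?linearN stripE ?opprK.
Qed.

(** The words killed by z, namely those starting with y or xx, are exactly those that [strip 1] does
    not kill. On xx w the identity holds only after evaluation, by yx = -xx. *)
Lemma strip_act_z v :
  eval (strip 2 (letter_act 2 v)) + letter 1 * eval (strip 1 v) = eval v.
Proof.
pose f : {linear V -> A} := (eval \o (strip 2 \o letter_act 2))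
  \+ (letter 1 \*o (eval \o strip 1)).
suff: f =1 eval by exact.
apply: free_module_ext => w.
rewrite -[LHS]/(eval (strip 2 (letter_act 2 (word w))) + letter 1 * eval (strip 1 (word w))).
rewrite letter_actE stripE.
have stripz u : eval (strip 2 (word (2 :: u))) + letter 1 * eval 0 = eval (word u).
  by rewrite stripE linear0 mulr0 addr0.
case: w => [|[|[|i]] w]; try exact: stripz.
  case: w => [|[|i] w]; try exact: stripz.
  rewrite [letter_step _ _]/= [strip_letter _ _]/= !linear0 add0r linearN mulrN.
  by rewrite !evalE !eval_word_cons [X in - X]mulrA letter_yx mulNr opprK -mulrA.
by rewrite [letter_step _ _]/= [strip_letter _ _]/= !linear0 add0r !evalE eval_word_cons.
Qed.

Lemma strip_act_x v :
  eval (strip 0 (letter_act 0 v)) + letter 2 * eval (strip 2 v) = eval v.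
Proof.
pose f : {linear V -> A} := (eval \o (strip 0 \o letter_act 0))
  \+ (letter 2 \*o (eval \o strip 2)).
suff: f =1 eval by exact.
apply: free_module_ext => w.
rewrite -[LHS]/(eval (strip 0 (letter_act 0 (word w))) + letter 2 * eval (strip 2 (word w))).
rewrite letter_actE stripE.
have stripx u : eval (strip 0 (word (0 :: u))) + letter 2 * eval 0 = eval (word u).
  by rewrite stripE linear0 mulr0 addr0.
case: w => [|[|[|[|i]]] w]; try exact: stripx.
by rewrite [letter_step _ _]/= [strip_letter _ _]/= !linear0 add0r !evalE eval_word_cons.
Qed.

(** The next three lemmas make these maps a contracting homotopy of 0 -> A -> A -> A -> A, with left
    multiplications by y, z, x. *)
Definition letter_div i : {linear A -> A} := eval \o (strip i \o normal_form).

Lemma letter_div_y a : letter_div 1 (letter 1 * a) = a.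
Proof.
by rewrite -[LHS]/(eval (strip 1 (normal_form (letter 1 * a)))) normal_form_letter //
  strip_act_y eval_normal_form.
Qed.

Lemma letter_div_z a : letter_div 2 (letter 2 * a) + letter 1 * letter_div 1 a = a.
Proof.
rewrite -[LHS]/(eval (strip 2 (normal_form (letter 2 * a)))
  + letter 1 * eval (strip 1 (normal_form a))).
by rewrite normal_form_letter // strip_act_z eval_normal_form.
Qed.

Lemma letter_div_x a : letter_div 0 (letter 0 * a) + letter 2 * letter_div 2 a = a.
Proof.
rewrite -[LHS]/(eval (strip 0 (normal_form (letter 0 * a)))
  + letter 2 * eval (strip 2 (normal_form a))).
by rewrite normal_form_letter // strip_act_x eval_normal_form.
Qed.

End NormalForms.

(** * The Koszul complex with coefficients in a bimodule *)

Section EnvelopingAlgebra.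
Variables (k : comPzRingType) (A : algType k).
Implicit Types a b : A.

Definition env_left a : env A := env_pure a 1.
Definition env_right b : env A := env_pure 1 b.

Lemma env_leftM a b : env_left a * env_left b = env_left (a * b).
Proof. by rewrite /env_left env_mulE mulr1. Qed.

Lemma env_rightM a b : env_right a * env_right b = env_right (b * a).
Proof. by rewrite /env_right env_mulE mulr1. Qed.

Lemma env_left_right a b : env_left a * env_right b = env_pure a b.
Proof. by rewrite /env_left /env_right env_mulE !mulr1. Qed.

Lemma env_right_left a b : env_right b * env_left a = env_pure a b.
Proof. by rewrite /env_left /env_right env_mulE !mul1r. Qed.

Lemma env_pureDl a a' b : env_pure (a + a') b = env_pure a b + env_pure a' b.
Proof. exact: atensDl. Qed.

Lemma env_pureDr a b b' : env_pure a (b + b') = env_pure a b + env_pure a b'.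
Proof. exact: atensDr. Qed.

Lemma env_leftD a b : env_left (a + b) = env_left a + env_left b.
Proof. exact: env_pureDl. Qed.

Lemma env_rightD a b : env_right (a + b) = env_right a + env_right b.
Proof. exact: env_pureDr. Qed.

Lemma env_left0 : env_left 0 = 0.
Proof. by apply: (addrI (env_left 0)); rewrite -env_leftD !addr0. Qed.

Lemma env_right0 : env_right 0 = 0.
Proof. by apply: (addrI (env_right 0)); rewrite -env_rightD !addr0. Qed.

End EnvelopingAlgebra.

Section KoszulComplex.
Variable k : fieldType.
Local Notation A := (algA k).
Local Notation x := (letter k 0).
Local Notation y := (letter k 1).
Local Notation z := (letter k 2).

(* A^e as a ring constant, which keeps unification from unfolding the tensor product. *)
Definition envA : pzRingType := env A.
Definition envl (a : A) : envA := env_left a.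
Definition envr (b : A) : envA := env_right b.

Lemma envlD a b : envl (a + b) = envl a + envl b.
Proof. exact: env_leftD. Qed.

Lemma envrD a b : envr (a + b) = envr a + envr b.
Proof. exact: env_rightD. Qed.

Lemma envl0 : envl 0 = 0.
Proof. exact: env_left0. Qed.

Lemma envr0 : envr 0 = 0.
Proof. exact: env_right0. Qed.

Lemma envlM a b : envl a * envl b = envl (a * b).
Proof. exact: env_leftM. Qed.

Lemma envrM a b : envr a * envr b = envr (b * a).
Proof. exact: env_rightM. Qed.

Lemma envrl a b : envr b * envl a = envl a * envr b.
Proof. exact: etrans (env_right_left a b) (esym (env_left_right a b)). Qed.

Lemma envl_scalar (c : k) b : envl c%:A * envl b = envl (c *: b).
Proof. by rewrite envlM -scalerAl mul1r. Qed.

Lemma envr_scalar (c : k) b : envl c%:A * envr b = envr (c *: b).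
Proof. exact: etrans (env_left_right c%:A b) (@atensZ k A A^c c 1 b). Qed.

Lemma envl_scalarC (c : k) a : envl a * envl c%:A = envl c%:A * envl a.
Proof. by rewrite !envlM -scalerAl -scalerAr mul1r mulr1. Qed.

(* A right A^e-module M is an A-bimodule, a (x) b acting by m |-> b m a. *)
Section Bimodule.
Variable M : lmodType envA^c.
Implicit Types (a b : A) (m : M).

Definition rmul a m : M := ract (envl a) m.
Definition lmul b m : M := ract (envr b) m.

Lemma rmulM a b m : rmul b (rmul a m) = rmul (a * b) m.
Proof. by rewrite /rmul ractM envlM. Qed.

Lemma lmul_rmul a b m : lmul b (rmul a m) = rmul a (lmul b m).
Proof.
by rewrite /lmul /rmul !ractM envrl.
Qed.

Lemma rmulD a m m' : rmul a (m + m') = rmul a m + rmul a m'.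
Proof. exact: ractDr. Qed.

Lemma lmulD a m m' : lmul a (m + m') = lmul a m + lmul a m'.
Proof. exact: ractDr. Qed.

Lemma rmulN a m : rmul a (- m) = - rmul a m.
Proof. exact: ractNr. Qed.

Lemma lmulN a m : lmul a (- m) = - lmul a m.
Proof. exact: ractNr. Qed.

Lemma rmul_eq0 a m : a = 0 -> rmul a m = 0.
Proof. by move->; rewrite /rmul envl0 ract0l. Qed.

End Bimodule.

Local Notation L := envl.
Local Notation R := envr.

Definition koszul_rank (n : nat) : nat :=
  match n with 0 => 1 | 1 | 2 => 3 | 3 => 2 | 4 => 1 | _ => 0 end.

(* The Koszul complex A (x) W_n (x) A, for W_1 = <x, y, z>, W_2 = <ux, xz, zy>,
   W_3 = <uxz, xzy> and W_4 = <uxzy>, where u = x + y. *)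
Definition koszul_rows (n : nat) : seq (seq envA) :=
  match n with
  | 0 => [:: [:: R x - L x]; [:: R y - L y]; [:: R z - L z]]
  | 1 => [:: [:: L (x + y) + R x; R x; 0]; [:: R z; 0; L x]; [:: 0; L z; R y]]
  | 2 => [:: [:: R z; - L (x + y); 0]; [:: 0; R y; - L x]]
  | 3 => [:: [:: R y; L (x + y)]]
  | _ => [::]
  end.

(** For a generator w = w'b = aw'' of W_n with outer factors a and b, the row encodes [w']b + (-1)^n
    a[w''], where [u] = [x] + [y]. *)
Definition koszul_diff n : 'M[envA]_(koszul_rank n.+1, koszul_rank n) :=
  \matrix_(i, j) nth 0 (nth [::] (koszul_rows n) i) j.

Lemma letter_ux : (x + y) * x = 0.
Proof. by rewrite mulrDl letter_xx_yx. Qed.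

Section Coefficients.
Variable M : lmodType envA^c.
Variable div : nat -> M -> M.
Hypothesis div0 : forall i, div i 0 = 0.
Hypothesis div_y : forall m, div 1 (lmul y m) = m.
Hypothesis div_z : forall m, div 2 (lmul z m) + lmul y (div 1 m) = m.
Hypothesis div_x : forall m, div 0 (lmul x m) + lmul z (div 2 m) = m.

Lemma lmul_y_reg (m : M) : lmul y m = 0 -> m = 0.
Proof. by move=> ym0; rewrite -[m]div_y ym0 div0. Qed.

Lemma lmul_z_ann (m : M) : lmul z m = 0 -> exists m', lmul y m' = m.
Proof. by move=> zm0; exists (div 1 m); rewrite -[RHS]div_z zm0 div0 add0r. Qed.

Lemma lmul_x_ann (m : M) : lmul x m = 0 -> exists m', lmul z m' = m.
Proof. by move=> xm0; exists (div 2 m); rewrite -[RHS]div_x xm0 div0 add0r. Qed.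

(** With u = x + y: y(cz) = -(bx)z = 0 gives cz = 0, hence xa = 0 and a = zq. Then z(qu + b) = 0
    gives qu + b = yp, and ux = 0 turns the last equation into y(c + px) = 0, where y cancels. *)
Lemma koszul_exact2 (a b c : M) :
    rmul (x + y) a + lmul x a + lmul z b = 0 -> lmul x a + rmul z c = 0 ->
    rmul x b + lmul y c = 0 ->
  exists q p, [/\ lmul z q = a, lmul y p - rmul (x + y) q = b & - rmul x p = c].
Proof.
move=> e1 e2 e3.
have zc0 : rmul z c = 0.
  apply: lmul_y_reg; rewrite lmul_rmul -[lmul y c](addKr (rmul x b)) e3 addr0 rmulN rmulM.
  by rewrite rmul_eq0 ?oppr0 // letter_xz.
have xa0 : lmul x a = 0 by rewrite zc0 addr0 in e2.
have [q qa] := lmul_x_ann xa0.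
have /lmul_z_ann[p pE] : lmul z (rmul (x + y) q + b) = 0.
  by rewrite lmulD lmul_rmul qa; rewrite xa0 addr0 in e1.
exists q, p; split=> //; first by rewrite pE addrC addKr.
apply/eqP; rewrite -subr_eq0; apply/eqP/lmul_y_reg.
rewrite lmulD !lmulN lmul_rmul pE rmulD rmulM [rmul (_ * x) _]rmul_eq0 ?letter_ux //.
by rewrite add0r -opprD e3 oppr0.
Qed.

Lemma koszul_exact3 (q p : M) :
    lmul z q = 0 -> lmul y p - rmul (x + y) q = 0 ->
  exists t, lmul y t = q /\ rmul (x + y) t = p.
Proof.
move=> /lmul_z_ann[t <-] e; exists t; split=> //.
apply/eqP; rewrite eq_sym -subr_eq0; apply/eqP/lmul_y_reg.
by rewrite lmulD lmulN lmul_rmul.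
Qed.

Lemma koszul_act1E (m : 'I_3 -> M) (j : 'I_3) :
  row_act m (koszul_diff 1) j = nth 0
    [:: rmul (x + y) (m ord0) + lmul x (m ord0) + lmul z (m (lift ord0 ord0));
        lmul x (m ord0) + rmul z (m (lift ord0 (lift ord0 ord0)));
        rmul x (m (lift ord0 ord0)) + lmul y (m (lift ord0 (lift ord0 ord0)))] j.
Proof.
rewrite /row_act !big_ord_recl big_ord0 !mxE.
case: j => -[|[|[|//]]] j3; rewrite [LHS]/= [RHS]/= ?ractDl !ract0l ?add0r ?addr0 //.
Qed.

Lemma koszul_act2E (m : 'I_2 -> M) (j : 'I_3) :
  row_act m (koszul_diff 2) j = nth 0
    [:: lmul z (m ord0); lmul y (m (lift ord0 ord0)) - rmul (x + y) (m ord0);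
        - rmul x (m (lift ord0 ord0))] j.
Proof.
rewrite /row_act !big_ord_recl big_ord0 !mxE.
case: j => -[|[|[|//]]] j3; rewrite [LHS]/= [RHS]/= ?ractNl ?ract0l ?add0r ?addr0 //.
by rewrite addrC.
Qed.

Lemma koszul_act3E (m : 'I_1 -> M) (j : 'I_2) :
  row_act m (koszul_diff 3) j = nth 0 [:: lmul y (m ord0); rmul (x + y) (m ord0)] j.
Proof.
rewrite /row_act big_ord_recl big_ord0 !mxE.
case: j => -[|[|//]] j2; rewrite [LHS]/= [RHS]/= addr0 //.
Qed.

Lemma koszul_row_exact n : row_exact M (koszul_diff n.+2) (koszul_diff n.+1).
Proof.
case: n => [|[|[|n]]] m m0; last by exists (fun=> 0) => -[].
- have e0 := m0 ord0; have e1 := m0 (lift ord0 ord0).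
  have e2 := m0 (lift ord0 (lift ord0 ord0)).
  rewrite !koszul_act1E in e0 e1 e2.
  have [q [p [qE pE cE]]] := koszul_exact2 e0 e1 e2.
  exists (fun i => nth 0 [:: q; p] i) => i; rewrite koszul_act2E [LHS]/= qE pE cE.
  by case: i => -[|[|[|//]]] i3; congr m; apply: val_inj.
- have e0 := m0 ord0; have e1 := m0 (lift ord0 ord0).
  rewrite !koszul_act2E in e0 e1; have [t [qE pE]] := koszul_exact3 e0 e1.
  exists (fun=> t) => i; rewrite koszul_act3E qE pE.
  by case: i => -[|[|//]] i2; congr m; apply: val_inj.
(* Nothing maps into the top degree 4; the differential leaving it is injective, already by its
   entry [R y]. *)
- have e0 := m0 ord0; rewrite koszul_act3E in e0.
  by exists (fun=> 0) => i; rewrite /row_act big_ord0 ord1 (lmul_y_reg e0).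
Qed.
End Coefficients.

Lemma koszul_row_exact_env_module n :
  row_exact (right_env_module A) (koszul_diff n.+2) (koszul_diff n.+1).
Proof.
have lmulE b (m : right_env_module A) : lmul b m = (b * m : A).
  by rewrite -[LHS]/(act_r (env_pure 1 b) m) act_rE mulr1.
apply: (@koszul_row_exact (right_env_module A)
  (fun i (a : right_env_module A) => (letter_div k i (a : A) : right_env_module A))) => [i|m|m|m]; rewrite ?lmulE.
- exact: linear0.
- exact: letter_div_y.
- exact: letter_div_z.
- exact: letter_div_x.
Qed.

Section TensorSquare.
Variable f : {linear A -> A}.

(** Division is applied to the second factor because that is where [lmul] acts on the regular
    module: (a ⊗ b)(1 ⊗ c) = a ⊗ cb. *)
Definition env_map (e : env A) : env A :=
  tens_lift (fun (a : right_module A) (b : A^c) => env_pure a (f b)) e.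

Fact env_map_balanced :
  balanced (fun (a : right_module A) (b : A^c) => env_pure a (f b)).
Proof.
split=> [a a' b|a b b'|a c b]; first exact: env_pureDl.
- by rewrite -env_pureDr -raddfD.
- by rewrite -[c *: b]/((c : k) *: (b : A)) linearZ; exact: atensZ.
Qed.

Lemma env_mapE a b : env_map (env_pure a b) = env_pure a (f b).
Proof. by rewrite {1}/env_pure atens.unlock; exact: (tens_liftE env_map_balanced a b). Qed.

Lemma env_mapB e e' : env_map (e - e') = env_map e - env_map e'.
Proof. exact: tens_lift_zmod_morphism env_map_balanced e e'. Qed.

Lemma env_map0 : env_map 0 = 0.
Proof. by rewrite -(subrr 0) env_mapB !subrr. Qed.
End TensorSquare.

Lemma koszul_row_exact_regular n :
  row_exact (envA^c)^o (koszul_diff n.+2) (koszul_diff n.+1).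
Proof.
have lmulE b (m : (envA^c)^o) : lmul b m = ((m : env A) * env_right b : env A) by [].
have pureM a b c : (env_pure a b : env A) * env_right c = env_pure a (c * b).
  by rewrite env_mulE mulr1.
apply: (@koszul_row_exact (envA^c)^o
  (fun i (e : (envA^c)^o) => (env_map (letter_div k i) e : (envA^c)^o))) => [i|m|m|m];
  rewrite ?lmulE; first exact: env_map0.
- elim/env_ind: m => [|e e' he he'|a b]; first by rewrite mul0r env_map0.
    by rewrite mulrBl env_mapB he he'.
  by rewrite pureM env_mapE letter_div_y.
- elim/env_ind: m => [|e e' he he'|a b]; first by rewrite mul0r !env_map0 mul0r addr0.
    by rewrite mulrBl !env_mapB mulrBl addrACA -opprD he he'.
  by rewrite pureM !env_mapE pureM -env_pureDr letter_div_z.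
- elim/env_ind: m => [|e e' he he'|a b]; first by rewrite mul0r !env_map0 mul0r addr0.
    by rewrite mulrBl !env_mapB mulrBl addrACA -opprD he he'.
  by rewrite pureM !env_mapE pureM -env_pureDr letter_div_x.
Qed.
End KoszulComplex.

(** * Fox derivatives and the Leibniz rule modulo boundaries *)

Lemma free_module_ind (R : pzRingType) (K : choiceType) (P : free_module R K -> Prop) :
    P 0 -> (forall c u v, P u -> P v -> P (c *: u + v)) -> (forall i, P << i >>) ->
  forall u, P u.
Proof.
move=> P0 PD PU u.
have -> : u = \sum_(i <- msupp u) u@_i *: (<< i >> : free_module R K).
  rewrite [LHS]monalgE; apply: eq_bigr => i _; apply/malgP => j.
  by rewrite free_scaleE !mcoeffU mulrnAr mulr1.
by elim/big_ind: _ => // [v w Pv Pw|i _]; [rewrite -[v]scale1r|rewrite -[_ *: _]addr0]; apply: PD.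
Qed.

Lemma mulmx_const_comb (R : pzRingType) p q (D : 'M[R]_(p, q)) a c (u v : 'rV[R]_p) b d :
    u *m D = const_mx b -> v *m D = const_mx d ->
  (a *: u + c *: v) *m D = const_mx (a * b + c * d).
Proof.
move=> ub vd; rewrite mulmxDl -!scalemxAl ub vd.
by apply/matrixP => i j; rewrite !mxE.
Qed.

(* L a and R b stand for a (x) 1 and 1 (x) b in A^e. Keeping the ring abstract here
   prevents unification from unfolding the tensor product. *)
Section EnvelopingIdentities.
Variables (A E : pzRingType) (L R : A -> E).
Hypothesis LD : forall a b, L (a + b) = L a + L b.
Hypothesis RD : forall a b, R (a + b) = R a + R b.
Hypothesis LM : forall a b, L a * L b = L (a * b).
Hypothesis RM : forall a b, R a * R b = R (b * a).
Hypothesis RL : forall a b, R b * L a = L a * R b.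

(** The Leibniz rule for the universal derivation sending a to 1 ⊗ a - a ⊗ 1. *)
Lemma fox_diffM a b : R b * (R a - L a) + L a * (R b - L b) = R (a * b) - L (a * b).
Proof. by rewrite !mulrBr RM LM RL addrA subrK. Qed.

Lemma fox_diff_linear c a b ca :
    L c * L a = L ca -> L c * R a = R ca ->
  L c * (R a - L a) + 1 * (R b - L b) = R (ca + b) - L (ca + b).
Proof. by move=> LL LR; rewrite mul1r mulrBr LL LR LD RD opprD addrACA. Qed.

Let L0 : L 0 = 0.
Proof. by apply: (addrI (L 0)); rewrite -LD !addr0. Qed.

Let R0 : R 0 = 0.
Proof. by apply: (addrI (R 0)); rewrite -RD !addr0. Qed.

Lemma monomial_cycle x z : x * z = 0 -> R z * (R x - L x) + L x * (R z - L z) = 0.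
Proof. by move=> xz0; rewrite !mulrBr RM LM xz0 L0 R0 RL subr0 sub0r addNr. Qed.

Lemma binomial_cycle x y : (x + y) * x = 0 ->
  (L (x + y) + R x) * (R x - L x) + R x * (R y - L y) = 0.
Proof.
move=> ux0; rewrite mulrDl !mulrBr LM ux0 L0 subr0 !RM !RL -addrA [_ - _ + _]addrACA -opprD.
by rewrite -RD -!mulrDl -LD ux0 R0 sub0r subrr.
Qed.

Section Syzygies.
Variables (M : lmodType E) (x y z w : A) (s t r d : M).

(** The left side is the failure of the Leibniz rule when xzw is rewritten to 0: s and t stand for
    the slots of z and x, and d for the derivative of w. The right side is a multiple of the row of
    the relation xz; d drops out because xz = 0. *)
Lemma monomial_syzygy : x * z = 0 ->
  - (L x *: (R w *: s + L z *: d)) - R (z * w) *: t = - R w *: (L x *: s + R z *: t).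
Proof.
move=> xz0; rewrite scaleNr !scalerDr !scalerA LM xz0 L0 scale0r addr0.
by rewrite RM RL opprD.
Qed.

Lemma binomial_syzygy : (x + y) * x = 0 ->
  - (R (x * w) *: s + L x *: (R w *: s + L x *: d)) - L y *: (R w *: s + L x *: d)
    - R (x * w) *: t
  = - R w *: ((L (x + y) + R x) *: s + R x *: t).
Proof.
move=> ux0; rewrite scaleNr -!opprD -[_ + _ + L y *: _]addrA -scalerDl -LD; congr (- _).
rewrite !scalerDr !scalerA LM ux0 L0 scale0r addr0 mulrDr RM RL scalerDl.
by rewrite [X in X + _]addrC.
Qed.

(** The combination of the rows of zy and ux on the right is dictated by -zxx = (zy)x - z(ux) in the
    free algebra, with u = x + y. *)
Lemma cubic_syzygy : (x + y) * x = 0 -> z * y = 0 -> z * (x * x) = 0 ->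
  - (L z *: (R (x * w) *: s + L x *: (R w *: s + L x *: d))) - R (x * (x * w)) *: r
  = R w *: (R x *: (L z *: t + R y *: r) - L z *: ((L (x + y) + R x) *: s + R x *: t)).
Proof.
move=> ux0 zy0 zxx0.
have RN a : R (- a) = - R a.
  by apply/eqP; rewrite -addr_eq0 -RD addNr; apply/eqP/(addrI (R 0)); rewrite -RD !addr0.
have yx : y * x = - (x * x) by apply/eqP; rewrite -addr_eq0 addrC -mulrDl ux0.
have zu : z * (x + y) = z * x by rewrite mulrDr zy0 addr0.
have e1 : R w * (R x * L z) = L z * R (x * w) by rewrite mulrA RM RL.
have e2 : R w * (R x * R y) = - R (x * (x * w)) by rewrite !RM yx mulNr RN mulrA.
have e3 : R w * (L z * L (x + y)) = L (z * x) * R w by rewrite LM zu RL.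
have e4 : R w * (L z * R x) = L z * R (x * w) by rewrite mulrA RL -mulrA RM.
have e5 : L z * (L x * R w) = L (z * x) * R w by rewrite mulrA LM.
have e6 : L z * (L x * L x) = 0 by rewrite !LM zxx0.
rewrite !(scalerDl, scalerBr, scalerDr) !scalerA -!mulrA e1 e2 e3 e4 e5 e6 scale0r addr0.
rewrite scaleNr [X in _ = _ - X]addrC [in RHS]opprD [in RHS]addrACA subrr add0r addrC.
by congr (- _ - _); exact: addrC.
Qed.
End Syzygies.
End EnvelopingIdentities.

Section RestrictScalars.
Variables (k E : pzRingType) (f : {rmorphism k -> E}) (M : lmodType E).

(** The morphism is a phantom argument: the alias carries the structure over [k] without overloading
    that of [M] over [E]. *)
Definition restrict_scalars of {rmorphism k -> E} : Type := M.
Local Notation Mk := (restrict_scalars f).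
HB.instance Definition _ := GRing.Zmodule.on Mk.

Definition restricted_scale (c : k) (u : Mk) : Mk :=
  f c *: (u : M).

Fact restricted_scaleA c d u :
  restricted_scale c (restricted_scale d u) = restricted_scale (c * d) u.
Proof. by rewrite /restricted_scale scalerA rmorphM. Qed.

Fact restricted_scale1 : left_id 1 restricted_scale.
Proof. by move=> u; rewrite /restricted_scale rmorph1; exact: scale1r. Qed.

Fact restricted_scaleDr : right_distributive restricted_scale +%R.
Proof. by move=> c u v; exact: scalerDr. Qed.

Fact restricted_scaleDl u : {morph restricted_scale^~ u : c d / c + d}.
Proof. by move=> c d; rewrite /restricted_scale rmorphD; exact: scalerDl. Qed.

HB.instance Definition _ := GRing.Zmodule_isLmodule.Build k Mk
  restricted_scaleA restricted_scale1 restricted_scaleDr restricted_scaleDl.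
End RestrictScalars.

Section FreeExtendScalars.
Variables (k E : pzRingType) (f : {rmorphism k -> E}) (M : lmodType E) (K : choiceType).
Variable g : K -> M.

Definition free_extend_over (v : free_module k K) : M :=
  free_extend (g : K -> restrict_scalars M f) v.

Lemma free_extend_overU i : free_extend_over << i >> = g i.
Proof. exact: (free_extendU (g : K -> restrict_scalars M f)). Qed.

Lemma free_extend_overP c u v :
  free_extend_over (c *: u + v) = f c *: free_extend_over u + free_extend_over v.
Proof. exact: (linearP (free_extend (g : K -> restrict_scalars M f))). Qed.
End FreeExtendScalars.

Section FoxDerivative.
Variable k : fieldType.
Local Notation A := (algA k).
Local Notation V := (free_module k (seq nat)).
Local Notation word w := (<< w >> : V).
Local Notation L := (@envl k).
Local Notation R := (@envr k).
Local Notation K1 := 'rV[envA k]_3.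

Definition slot (i : nat) : K1 := delta_mx 0 (inord i).

(* The letters i > 2 are evaluated like x, since inord i is then 0. *)
Fixpoint fox_word (w : seq nat) : K1 :=
  if w is i :: w' then R (eval_word k w') *: slot i + L (letter k i) *: fox_word w' else 0.

Definition envA_scalar (c : k) : envA k := L c%:A.

Fact envA_scalar_zmod_morphism : zmod_morphism envA_scalar.
Proof.
move=> c d; apply/eqP; rewrite eq_sym subr_eq -envlD -scalerDl; apply/eqP.
by rewrite subrK.
Qed.
HB.instance Definition _ :=
  GRing.isZmodMorphism.Build k (envA k) envA_scalar envA_scalar_zmod_morphism.

Fact envA_scalar_monoid_morphism : monoid_morphism envA_scalar.
Proof.
split=> [|c d]; first by rewrite /envA_scalar scale1r.
by rewrite /envA_scalar envl_scalar scalerA.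
Qed.
HB.instance Definition _ :=
  GRing.isMonoidMorphism.Build k (envA k) envA_scalar envA_scalar_monoid_morphism.

Definition fox : V -> K1 := free_extend_over envA_scalar fox_word.

Lemma foxE w : fox (word w) = fox_word w.
Proof. exact: free_extend_overU. Qed.

Lemma foxP c u v : fox (c *: u + v) = L c%:A *: fox u + fox v.
Proof. exact: free_extend_overP. Qed.

Lemma foxD u v : fox (u + v) = fox u + fox v.
Proof. by rewrite -[u]scale1r foxP !scale1r. Qed.

Lemma fox0 : fox 0 = 0.
Proof. by apply: (addrI (fox 0)); rewrite -foxD !addr0. Qed.

Lemma foxZ c v : fox (c *: v) = L c%:A *: fox v.
Proof. by rewrite -[c *: v]addr0 foxP fox0 addr0. Qed.

Lemma slot_diff i : slot i *m koszul_diff k 0 = const_mx (R (letter k i) - L (letter k i)).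
Proof.
apply/rowP => j; rewrite mxE (bigD1 (inord i)) //= !mxE !eqxx mul1r big1 ?addr0.
  have -> : letter k i = letter k (inord i : 'I_3) by rewrite /letter /gen inord_val.
  by rewrite ord1; case: (inord i : 'I_3) => -[|[|[|]]].
by move=> l lj; rewrite mxE (negPf lj) andbF mul0r.
Qed.

(** The fundamental formula of Fox calculus; the sum over the letters telescopes by the Leibniz
    rule. *)
Lemma fox_word_diff w : fox_word w *m koszul_diff k 0
  = const_mx (R (eval_word k w) - L (eval_word k w)).
Proof.
elim: w => [|i w IHw].
  by rewrite mul0mx /eval_word big_nil subrr; apply/rowP => j; rewrite !mxE.
rewrite eval_word_cons -(fox_diffM (@envlM k) (@envrM k) (@envrl k)).
exact: (mulmx_const_comb (R (eval_word k w)) (L (letter k i)) (slot_diff i) IHw).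
Qed.

Lemma fox_diff v : fox v *m koszul_diff k 0 = const_mx (R (eval k v) - L (eval k v)).
Proof.
elim/free_module_ind: v => [|c u v hu hv|w].
- rewrite fox0 linear0 mul0mx envl0 envr0 subrr.
  by apply/rowP => j; rewrite !mxE.
- have := mulmx_const_comb (L c%:A) 1 hu hv.
  rewrite (fox_diff_linear (@envlD k) (@envrD k) _ (envl_scalar c _) (envr_scalar c _)).
  by rewrite scale1r -foxP -(linearP (eval k)).
- by rewrite foxE evalE fox_word_diff.
Qed.

End FoxDerivative.

Section RowImage.
Variables (E : pzRingType) (p q : nat) (D : 'M[E]_(p, q)).

Definition row_image (u : 'rV[E]_q) := exists v, v *m D = u.

Lemma row_image0 : row_image 0.
Proof. by exists 0; rewrite mul0mx. Qed.

Lemma row_imageP a u v : row_image u -> row_image v -> row_image (a *: u + v).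
Proof. by move=> [u' <-] [v' <-]; exists (a *: u' + v'); rewrite mulmxDl scalemxAl. Qed.

Lemma row_image_scale a u : row_image u -> row_image (a *: u).
Proof. by move=> Du; rewrite -[_ *: u]addr0; apply: row_imageP => //; exact: row_image0. Qed.

Lemma row_image_sub u v : row_image u -> row_image v -> row_image (u - v).
Proof. by move=> Du Dv; rewrite addrC -scaleN1r; exact: row_imageP. Qed.

Lemma delta_mulmx_pair i j1 j2 a b : j1 != j2 ->
    (forall j, D i j = if j == j1 then a else if j == j2 then b else 0) ->
  (delta_mx 0 i : 'rV[E]_p) *m D = a *: delta_mx 0 j1 + b *: delta_mx 0 j2.
Proof.
move=> j12 DE; apply/rowP => j; rewrite -rowE !mxE DE eqxx /=.
case: (j =P j1) => [->|_]; first by rewrite (negPf j12) mulr1 mulr0 addr0.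
by case: (j =P j2) => _; rewrite mulr0 ?mulr1 ?mulr0 add0r.
Qed.
End RowImage.

Lemma defect_linear (E : pzRingType) (M : lmodType E) (c l e1 e2 ce1 : E)
    (f1 f2 g1 g2 s : M) : l * c = c * l -> c * e1 = ce1 ->
  c *: f1 + f2 - l *: (c *: g1 + g2) - (ce1 + e2) *: s
  = c *: (f1 - l *: g1 - e1 *: s) + (f2 - l *: g2 - e2 *: s).
Proof.
move=> lc <-; rewrite !scalerBr scalerDr !scalerA scalerDl lc.
by rewrite !opprD !addrA; congr (_ - _); rewrite addrAC; congr (_ - _);
  rewrite -!addrA; congr (_ + _); rewrite addrCA; congr (_ + _); rewrite addrC.
Qed.

Section FoxDefect.
Variable k : fieldType.
Local Notation A := (algA k).
Local Notation V := (free_module k (seq nat)).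
Local Notation word w := (<< w >> : V).
Local Notation L := (@envl k).
Local Notation R := (@envr k).
Local Notation x := (letter k 0).
Local Notation y := (letter k 1).
Local Notation z := (letter k 2).
Local Notation image1 := (@row_image (envA k) 3 3 (koszul_diff k 1)).

Lemma slotE (j : 'I_3) : slot k j = delta_mx 0 j.
Proof. by rewrite /slot inord_val. Qed.

Local Notation o0 := (@Ordinal 3 0 isT).
Local Notation o1 := (@Ordinal 3 1 isT).
Local Notation o2 := (@Ordinal 3 2 isT).

Lemma image_ux : image1 ((L (x + y) + R x) *: slot k 0 + R x *: slot k 1).
Proof.
exists (delta_mx 0 o0); rewrite (slotE o0) (slotE o1).
refine (@delta_mulmx_pair _ 3 3 (koszul_diff k 1) o0 o0 o1 _ _ isT _) => j.
by rewrite mxE; case: j => -[|[|[|//]]] j3; reflexivity.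
Qed.

Lemma image_xz : image1 (L x *: slot k 2 + R z *: slot k 0).
Proof.
exists (delta_mx 0 o1); rewrite (slotE o0) (slotE o2).
refine (@delta_mulmx_pair _ 3 3 (koszul_diff k 1) o1 o2 o0 _ _ isT _) => j.
by rewrite mxE; case: j => -[|[|[|//]]] j3; reflexivity.
Qed.

Lemma image_zy : image1 (L z *: slot k 1 + R y *: slot k 2).
Proof.
exists (delta_mx 0 o2); rewrite (slotE o1) (slotE o2).
refine (@delta_mulmx_pair _ 3 3 (koszul_diff k 1) o2 o1 o2 _ _ isT _) => j.
by rewrite mxE; case: j => -[|[|[|//]]] j3; reflexivity.
Qed.

Lemma fox_defect_letter i w :
  image1 (fox (word (i :: w)) - L (letter k i) *: fox_word k w - R (eval_word k w) *: slot k i).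
Proof.
suff -> : fox (word (i :: w)) - L (letter k i) *: fox_word k w - R (eval_word k w) *: slot k i = 0.
  exact: row_image0.
by rewrite foxE [fox_word _ _]/= addrK subrr.
Qed.

Lemma foxN (v : V) : fox (- v) = - fox v.
Proof. by apply/eqP; rewrite -addr_eq0 -foxD addNr fox0. Qed.

(** Prepending a letter without rewriting obeys the Leibniz rule exactly. Each of the four rewriting
    rules contributes a combination of rows of the relations it comes from. *)
Lemma fox_defect_word i w : (i < 3)%N ->
  image1 (fox (letter_step k i w) - L (letter k i) *: fox_word k w - R (eval_word k w) *: slot k i).
Proof.
case: i => [|[|[|//]]] _.
- case: w => [|[|[|[|j]]] w]; try exact: fox_defect_letter.
  rewrite [letter_step _ _ _]/= fox0 sub0r [fox_word _ _]/= eval_word_cons.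
  rewrite (monomial_syzygy (@envlD k) (@envlM k) (@envrM k) (@envrl k)) ?letter_xz //.
  exact/row_image_scale/image_xz.
- case: w => [|[|j] w]; try exact: fox_defect_letter.
  rewrite [letter_step _ _ _]/= foxN foxE [fox_word _ (_ :: _)]/= [fox_word _ (_ :: w)]/=.
  rewrite eval_word_cons.
  rewrite (binomial_syzygy (@envlD k) (@envlM k) (@envrM k) (@envrl k)) ?letter_ux //.
  exact/row_image_scale/image_ux.
- case: w => [|[|[|j]] w]; try exact: fox_defect_letter.
    case: w => [|[|j] w]; try exact: fox_defect_letter.
    rewrite [letter_step _ _ _]/= fox0 sub0r [fox_word _ _]/= !eval_word_cons.
    rewrite (@cubic_syzygy _ _ _ _ (@envlD k) (@envrD k) (@envlM k) (@envrM k) (@envrl k) _ x y z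
      (eval_word k w) (slot k 0) (slot k 1))
      ?letter_ux ?letter_zy ?letter_zxx //.
    apply/row_image_scale/row_image_sub; apply: row_image_scale; first exact: image_zy.
    exact: image_ux.
  rewrite [letter_step _ _ _]/= fox0 sub0r [fox_word _ _]/= eval_word_cons.
  rewrite (monomial_syzygy (@envlD k) (@envlM k) (@envrM k) (@envrl k)) ?letter_zy //.
  exact/row_image_scale/image_zy.
Qed.

Lemma fox_defect i (v : V) : (i < 3)%N ->
  image1 (fox (letter_act k i v) - L (letter k i) *: fox v - R (eval k v) *: slot k i).
Proof.
move=> i3; elim/free_module_ind: v => [|c u v hu hv|w].
- rewrite (linear0 (letter_act k i)) (linear0 (eval k)) fox0 envr0 scale0r scaler0 !subr0.
  exact: row_image0.
- rewrite (linearP (letter_act k i)) (linearP (eval k)) !foxP envrD.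
  rewrite (defect_linear _ _ _ _ _ _ (envl_scalarC c _) (envr_scalar c _)).
  exact: (row_imageP (L c%:A) hu hv).
- by rewrite letter_actE foxE evalE; exact: fox_defect_word.
Qed.
End FoxDefect.

(** * The Koszul resolution and the vanishing of homology *)

Section KoszulResolution.
Variable k : fieldType.
Local Notation A := (algA k).
Local Notation L := (@envl k).
Local Notation R := (@envr k).
Local Notation x := (letter k 0).
Local Notation y := (letter k 1).
Local Notation z := (letter k 2).

Definition contraction (e : env A) : 'rV[envA k]_3 :=
  tens_lift (fun (a : right_module A) (b : A^c) => L a *: fox (normal_form b)) e.

Fact contraction_balanced :
  balanced (fun (a : right_module A) (b : A^c) => L a *: fox (normal_form b)).
Proof.
split=> [a a' b|a b b'|a c b].
- by rewrite -[L (a + a')]/(L ((a : A) + (a' : A))) envlD scalerDl.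
- rewrite -[normal_form (b + b')]/(normal_form ((b : A) + (b' : A))).
  by rewrite (linearD (@normal_form k)) foxD scalerDr.
- rewrite -[normal_form (c *: b)]/(normal_form ((c : k) *: (b : A))).
  rewrite (linearZ_LR (@normal_form k)) foxZ scalerA envl_scalarC envl_scalar.
  by [].
Qed.

Lemma contractionE a b : contraction (env_pure a b) = L a *: fox (normal_form b).
Proof. by rewrite /env_pure atens.unlock; exact: (tens_liftE contraction_balanced a b). Qed.

Lemma contractionB e e' : contraction (e - e') = contraction e - contraction e'.
Proof. exact: tens_lift_zmod_morphism contraction_balanced e e'. Qed.

Lemma contraction0 : contraction 0 = 0.
Proof. by rewrite -(subrr 0) contractionB !subrr. Qed.

Lemma envlr a b : L a * R b = env_pure a b.
Proof. exact: env_left_right. Qed.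

(** Homotopy identity in degree 0 for the splitting of the augmentation by a -> a ⊗ 1: on a ⊗ b both
    sides are a ⊗ b - ab ⊗ 1. *)
Lemma contraction_diff (e : envA k) :
  contraction e *m koszul_diff k 0 = const_mx (e - L (act_l e 1)).
Proof.
have const_mxB (E : pzRingType) m n (a b : E) :
    const_mx (a - b) = const_mx a - const_mx b :> 'M_(m, n).
  by apply/matrixP => i j; rewrite !mxE.
elim/env_ind: e => [|e e' he he'|a b].
- rewrite contraction0 mul0mx; apply/esym/matrixP => i j; rewrite !mxE.
  have -> : act_l (0 : env A) 1 = 0 by rewrite -(subrr 0) act_lB !subrr.
  by rewrite envl0 subrr.
- rewrite contractionB mulmxBl he he' act_lB -const_mxB; congr const_mx.
  have -> : L (act_l e 1 - act_l e' 1) = L (act_l e 1) - L (act_l e' 1).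
    by apply/eqP; rewrite eq_sym subr_eq -envlD subrK.
  by rewrite !opprB addrACA [X in _ + X]addrC addrACA.
- rewrite contractionE -scalemxAl fox_diff eval_normal_form act_lE mulr1.
  by apply/matrixP => i j; rewrite !mxE mulrBr envlM envlr.
Qed.

Lemma koszul_diff0E (v : 'rV[envA k]_3) :
  (v *m koszul_diff k 0) 0 0 = \sum_(i < 3) v 0 i * (R (letter k i) - L (letter k i)).
Proof.
rewrite mxE; apply: eq_bigr => i _; congr (_ * _); rewrite mxE.
by case: i => -[|[|[|//]]] i3.
Qed.

(** Stands in for the homotopy identity in degree 1, whose second term is only known to be a
    boundary; a cycle [v] is then a boundary as well. *)
Lemma contraction_defect (v : 'rV[envA k]_3) :
  row_image (koszul_diff k 1) (contraction ((v *m koszul_diff k 0) 0 0) - v).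
Proof.
pose image (u : 'rV[envA k]_3) := @row_image (envA k) 3 3 (koszul_diff k 1) u.
suff: image (contraction ((v *m koszul_diff k 0) 0 0) - v) by [].
have contraction_sum (f : 'I_3 -> envA k) :
    contraction (\sum_i f i) = \sum_i contraction (f i).
  apply: (big_morph contraction _ contraction0) => e e'.
  rewrite -{1}[e']opprK contractionB -[- e']sub0r contractionB contraction0 sub0r.
  by rewrite opprK.
rewrite koszul_diff0E contraction_sum [X in _ - X]row_sum_delta -sumrB.
have imageD u w : image u -> image w -> image (u + w).
  by move=> Du Dw; rewrite -[u]scale1r; exact: row_imageP.
elim/big_ind: _ => [|u w Du Dw|i _]; [exact: row_image0|exact: imageD|].
elim/env_ind: (v 0 i) => [|e e' he he'|a b].
- by rewrite mul0r contraction0 scale0r subr0; exact: row_image0.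
- by rewrite mulrBl contractionB scalerBl opprD addrACA -opprD; exact: row_image_sub.
have -> : (env_pure a b : envA k) * (R (letter k i) - L (letter k i))
    = (env_pure a (letter k i * b) : envA k) - env_pure (a * letter k i) b.
  by rewrite -!envlr mulrBr -!mulrA envrM envrl mulrA envlM.
rewrite contractionB !contractionE normal_form_letter //.
(* On a ⊗ b in slot i, the difference is [L a] times the Leibniz defect of the letter i before b. *)
have := row_image_scale (L a) (fox_defect (normal_form b) (ltn_ord i)).
rewrite eval_normal_form !scalerBr !scalerA envlM slotE envlr.
by [].
Qed.

Lemma koszul_diff_comp n : koszul_diff k n.+1 *m koszul_diff k n = 0.
Proof.
have xz := letter_xz k; have zy := letter_zy k; have ux := letter_ux k.
have vanish a b (ab0 : a * b = 0) : L a * L b = 0 /\ R b * R a = 0.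
  by rewrite envlM envrM ab0 envl0 envr0.
have [Lxz Rxz] := vanish _ _ xz; have [Lzy Rzy] := vanish _ _ zy.
have [Lux _] := vanish _ _ ux.
case: n => [|[|[|n]]]; apply/matrixP => i j; last by case: i.
- rewrite [j]ord1 [RHS]mxE mxE !big_ord_recl big_ord0 !mxE.
  case: i => -[|[|[|//]]] i3; rewrite [LHS]/= !mul0r ?add0r ?addr0.
  + by rewrite (binomial_cycle (@envlD k) (@envrD k) (@envlM k) (@envrM k) (@envrl k) ux).
  + by rewrite (monomial_cycle (@envlD k) (@envrD k) (@envlM k) (@envrM k) (@envrl k) xz).
  + by rewrite addrC (monomial_cycle (@envlD k) (@envrD k) (@envlM k) (@envrM k) (@envrl k) zy).
- rewrite [RHS]mxE mxE !big_ord_recl big_ord0 !mxE.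
  case: i => -[|[|//]] i2; case: j => -[|[|[|//]]] j3; rewrite [LHS]/= ?mul0r ?mulr0 ?addr0 ?add0r.
  + by rewrite mulrDr Rxz addr0 mulNr envrl subrr.
  + by rewrite Rxz.
  + by rewrite mulNr Lux oppr0.
  + by rewrite Rzy.
  + by rewrite mulNr Lxz oppr0.
  + by rewrite mulNr envrl subrr.
- rewrite [RHS]mxE mxE !big_ord_recl big_ord0 !mxE.
  case: i => -[|//] i1; case: j => -[|[|[|//]]] j3; rewrite [LHS]/= ?mul0r ?mulr0 ?addr0 ?add0r.
  + by rewrite Rzy.
  + by rewrite mulrN envrl addNr.
  + by rewrite mulrN Lux oppr0.
Qed.

Definition koszul_aug (v : 'rV[envA k]_1) : left_env_module A := act_l (v 0 0) 1.

Fact koszul_aug_linear : linear koszul_aug.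
Proof.
move=> a u v; rewrite /koszul_aug !mxE.
rewrite -[LHS]/((a * u 0 0 + v 0 0 : env A) *: (1 : left_env_module A)).
by rewrite scalerDl -scalerA.
Qed.
HB.instance Definition _ := GRing.isLinear.Build (envA k) 'rV[envA k]_1 (left_env_module A)
  *:%R koszul_aug koszul_aug_linear.

Lemma koszul_aug_surj (a : left_env_module A) : exists v, koszul_aug v = a.
Proof. by exists (const_mx (L a)); rewrite /koszul_aug mxE act_lE !mulr1. Qed.

Lemma koszul_exact0 (v : 'rV[envA k]_1) :
  koszul_aug v = 0 <-> exists w, mulmx_row_map (koszul_diff k 0) w = v.
Proof.
split=> [v0|[w <-]].
  exists (contraction (v 0 0)); rewrite /mulmx_row_map contraction_diff -[act_l _ _]/(koszul_aug v) v0.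
  by apply/matrixP => i j; rewrite envl0 subr0 !ord1 mxE.
rewrite /koszul_aug koszul_diff0E.
rewrite -[LHS]/((\sum_(i < 3) w 0 i * (R (letter k i) - L (letter k i)) : env A)
  *: (1 : left_env_module A)).
rewrite scaler_suml big1 // => i _; rewrite -scalerA.
rewrite -[X in _ *: X]/(act_l (R (letter k i) - L (letter k i)) 1) act_lB !act_lE.
by rewrite !mulr1 mul1r subrr scaler0.
Qed.

Lemma koszul_exactS n (v : 'rV[envA k]_(koszul_rank n.+1)) :
  mulmx_row_map (koszul_diff k n) v = 0 <-> exists w, mulmx_row_map (koszul_diff k n.+1) w = v.
Proof.
split=> [v0|[w <-]]; last by rewrite /mulmx_row_map -mulmxA koszul_diff_comp mulmx0.
case: n v v0 => [|n] v v0.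
  (* For a cycle [v] the contraction term is zero and the defect is -v, hence the sign of the
     witness. *)
  have [w wE] := contraction_defect v; exists (- w).
  have e0 : (v *m koszul_diff k 0) 0 0 = 0 by rewrite [_ *m _]v0 mxE.
  by rewrite e0 contraction0 sub0r in wE; rewrite /mulmx_row_map mulNmx wE opprK.
by have [w wv] := row_exact_regular (@koszul_row_exact_regular k n) v0; exists w.
Qed.

Definition koszul_resolution : @projective_resolution (envA k) (left_env_module A) :=
  @ProjectiveResolution (envA k) (left_env_module A)
    (fun n => 'rV[envA k]_(koszul_rank n)) (fun n => mulmx_row_map (koszul_diff k n)) koszul_aug
    (fun n => @row_projective (envA k) (koszul_rank n))
    koszul_aug_surj koszul_exact0 koszul_exactS.

Lemma koszul_Tor_exact n :
  @Tor_exact (envA k) (left_env_module A) (right_env_module A) koszul_resolution n.+1.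
Proof. by move=> t t0; exact: row_exact_tens (@koszul_row_exact_env_module k n) t0. Qed.
End KoszulResolution.

Theorem proposition3p3 (k : fieldType) (char0 : [pchar k] =i pred0)
    (n : nat) (n_neq0 : n <> 0%N) (n_neq1 : n <> 1%N)
    (P : projective_resolution (left_env_module (algA k)))
    (h : HH P n) :
  h = 0.
Proof.
case: n n_neq0 n_neq1 h => [//|[//|n]] _ _ h.
(* The degree is now n + 2, so the outgoing differential has index n + 1. *)
apply: homology_eq0 => t; exact: (Tor_exact_comparison (@koszul_Tor_exact k n)).
Qed.
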